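(* Let $\mathbb{K}$ be a field and $G$ a connected chordal graph on $[n]$. Let $S=\mathbb{K}[x_1,\ldots,x_n,y_1,\ldots,y_n]$ and $J_G=(x_iy_j-x_jy_i : i<j,\ \{i,j\}\in E(G))$ be the binomial edge ideal of $G$. Then $\beta_{i,j}^S(S/J_G)=0$ for all $j>2i$.
   Context: $S$ is standard graded and $\beta^S_{i,j}$ are the graded Betti numbers. A graph is chordal if it has no induced cycle of length at least $4$. *)

(* Defs.v *)
From HB Require Import structures.
From mathcomp Require Import all_boot all_order all_algebra.
From mathcomp Require Import mpoly.
Set Implicit Arguments. Unset Strict Implicit. Unset Printing Implicit Defensive.
Import Order.TTheory GRing.Theory.
Local Open Scope ring_scope.

Definition simple_graph (T : finType) (e : rel T) : Prop :=
  ssrbool.symmetric e /\ ssrbool.irreflexive e.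

Definition connected_graph (T : finType) (e : rel T) : Prop :=
  forall x y : T, connect e x y.

Definition induced_cycle (T : finType) (e : rel T) (k : nat) (f : 'I_k -> T) : Prop :=
  (3 < k)%N /\ injective f /\
  forall i j : 'I_k,
    e (f i) (f j) = ((j : nat) == (i.+1 %% k)%N) || ((i : nat) == (j.+1 %% k)%N).

Definition chordal (T : finType) (e : rel T) : Prop :=
  forall (k : nat) (f : 'I_k -> T), ~ induced_cycle e f.

Notation Sring K n := {mpoly K[n + n]}.

Definition xvar (K : fieldType) (n : nat) (i : 'I_n) : Sring K n := 'X_(lshift n i).
Definition yvar (K : fieldType) (n : nat) (i : 'I_n) : Sring K n := 'X_(rshift n i).

Definition fij (K : fieldType) (n : nat) (i j : 'I_n) : Sring K n :=
  xvar K i * yvar K j - xvar K j * yvar K i.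

Definition in_JG (K : fieldType) (n : nat) (e : rel 'I_n) (p : Sring K n) : Prop :=
  exists c : 'I_n -> 'I_n -> Sring K n,
    p = \sum_(i < n) \sum_(j < n | (i < j)%N && e i j) c i j * fij K i j.

(* F_i = (+)_{a < r i} S(-d i a), maps written on row vectors:
   del i : F_(i+1) -> F_i,  eps : F_0 -> S (followed by S -> S/J). *)
Record graded_free_resolution (K : fieldType) (n : nat) (J : Sring K n -> Prop) := {
  rk : nat -> nat;
  shift : forall i : nat, 'I_(rk i) -> nat;
  del : forall i : nat, 'M[Sring K n]_(rk i.+1, rk i);
  eps : 'M[Sring K n]_(rk 0, 1);
  del_graded : forall i (a : 'I_(rk i.+1)) (b : 'I_(rk i)),
     if (shift b <= shift a)%N then del i a b \is (shift a - shift b)%N.-homog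
     else del i a b == 0;
  eps_graded : forall a : 'I_(rk 0), eps a ord0 \is (shift a).-homog;
  eps_surj : forall p : Sring K n, exists v : 'rV_(rk 0), J (p - (v *m eps) ord0 ord0);
  exact0 : forall v : 'rV_(rk 0),
     J ((v *m eps) ord0 ord0) <-> exists w : 'rV_(rk 1), v = w *m del 0;
  exactS : forall i (v : 'rV_(rk i.+1)),
     v *m del i = 0 <-> exists w : 'rV_(rk i.+2), v = w *m del i.+1
}.

(* minimality: all differentials have entries in the homogeneous maximal ideal *)
Definition minimal_resolution (K : fieldType) (n : nat) (J : Sring K n -> Prop)
  (F : graded_free_resolution J) : Prop :=
  forall i a b, (@del _ _ _ F i a b)@_0%MM = 0.

(* graded Betti number beta_{i,j}^S(S/J) read off a minimal graded free
   resolution F: the number of summands S(-j) of F_i *)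
Definition betti (K : fieldType) (n : nat) (J : Sring K n -> Prop)
  (F : graded_free_resolution J) (i j : nat) : nat :=
  #|[set a : 'I_(rk F i) | @shift _ _ _ F i a == j]|.

(* Main.v *)
(* A graph is chordal iff it has a perfect elimination ordering (Dirac).  Let v
   be the first non-isolated vertex in such an ordering, uv an edge, G' = G - uv
   and W the set of neighbours of v in G'.  Then J_G = J_G' + (f_uv) and
   J_G' : f_uv = J_H + (x_w, y_w : w in W), where H is obtained from G' - W by
   completing the neighbourhood of u; the same ordering is a perfect elimination
   ordering of G' and of H.  As f_uv has degree 2, the long exact sequence of
   Koszul homology propagates the vanishing of Tor_i(S/J, K)_j for j > 2i from G'
   and from the colon ideal to G.
   The colon ideal is computed by showing that f_uv is regular modulo J_H when u
   is simplicial and v isolated in H: Ohtani's decomposition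
   J_H = J_(H_w) /\ ((x_w, y_w) + J_(H - w)) reduces this to disjoint unions of
   cliques, whose ideals are kernels of monomial maps into domains.
   Finally, dimension shifting along a minimal resolution F turns a basis element
   of F_i of degree j into a nonzero class in Koszul homology. *)
Require Import Defs.
From HB Require Import structures.
From mathcomp Require Import all_boot all_order all_algebra.
From mathcomp Require Import ring zify mpoly.
Set Implicit Arguments. Unset Strict Implicit. Unset Printing Implicit Defensive.
Import Order.TTheory GRing.Theory.
Local Open Scope ring_scope.

(** * The Koszul complex *)

Section DegreeProjection.

Variables (K : fieldType) (N : nat).
Implicit Types (p q g : {mpoly K[N]}) (Q : pred nat) (m : 'X_{1..N}).

(** A predicate on degrees, not a single degree, so that a range such as all t > a is selected in
    one go. *)
Definition mproj Q p : {mpoly K[N]} :=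
  \sum_(m <- msupp p | Q (mdeg m)) p@_m *: 'X_[m].

Lemma mcoeff_mproj Q p m : (mproj Q p)@_m = if Q (mdeg m) then p@_m else 0.
Proof.
rewrite /mproj raddf_sum /=.
under eq_bigr do rewrite mcoeffZ mcoeffX.
have [mp|mp] := boolP (m \in msupp p); last first.
  rewrite (memN_msupp_eq0 mp) if_same big_seq_cond big1 // => i /andP[ip _].
  by have [im|] := eqVneq i m; [rewrite -im ip in mp | rewrite mulr0].
rewrite big_mkcond (bigD1_seq m) //= eqxx mulr1 big1 ?addr0 // => i /negPf ->.
by rewrite mulr0 if_same.
Qed.

Lemma mproj_is_linear Q : linear (mproj Q).
Proof.
move=> c p q; apply/mpolyP => m.
rewrite mcoeffD mcoeffZ !mcoeff_mproj mcoeffD mcoeffZ.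
by case: ifP => // _; rewrite mulr0 addr0.
Qed.

HB.instance Definition _ Q :=
  GRing.isLinear.Build K {mpoly K[N]} {mpoly K[N]} _ (mproj Q) (mproj_is_linear Q).

Lemma eq_mproj Q Q' p : Q =1 Q' -> mproj Q p = mproj Q' p.
Proof. by move=> e; apply/mpolyP => m; rewrite !mcoeff_mproj e. Qed.

Lemma mproj_comp Q Q' p : mproj Q (mproj Q' p) = mproj (predI Q Q') p.
Proof.
by apply/mpolyP => m; rewrite !mcoeff_mproj /=; case: (Q _); case: (Q' _).
Qed.

Lemma mprojM Q p g d : g \is d.-homog ->
  mproj Q (p * g) = mproj (fun e => Q (e + d)%N) p * g.
Proof.
move=> hg; apply/mpolyP => m; rewrite mcoeff_mproj !mcoeffM.
have E m1 m2 : m == (m1 + m2)%MM -> g@_m2 != 0 -> mdeg m = (mdeg m1 + d)%N.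
  move=> /eqP-> gk; rewrite mdegD; congr addn; apply: (dhomog_mf hg).
  by rewrite mcoeff_msupp.
case: ifP => Qm; [apply: eq_bigr | apply/esym/big1] => k mk;
  rewrite mcoeff_mproj; have [->|gk] := eqVneq (g@_k.2) 0; rewrite ?mulr0 //;
  by rewrite -(E _ _ mk gk) Qm // mul0r.
Qed.

Lemma mproj_homog Q g d : g \is d.-homog -> mproj Q g = if Q d then g else 0.
Proof.
move=> hg; apply/mpolyP => m; rewrite mcoeff_mproj.
have [gm|gm] := eqVneq (g@_m) 0; first by do 2!case: ifP; rewrite ?gm ?mcoeff0.
rewrite (dhomog_mf hg); last by rewrite mcoeff_msupp.
by case: ifP; rewrite ?mcoeff0.
Qed.

End DegreeProjection.

(** * Koszul chains, their differential and acyclicity *)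

Section Koszul.

Variables (K : fieldType) (N : nat).
Local Notation S := {mpoly K[N]}.

(* An element of the Koszul complex on the first k variables with coefficients
   in S^r is a pair (a, b) standing for a + b /\ e_k, with a and b in the
   complex on the first k - 1 variables. *)
Fixpoint kos (r k : nat) : lmodType S :=
  if k is k'.+1 then ((kos r k' * kos r k')%type : lmodType S) else 'rV[S]_r.

Definition kvar (k : nat) : S :=
  if insub k is Some i then 'X_i else 0.

Lemma kvarE (i : 'I_N) : kvar i = 'X_i.
Proof. by rewrite /kvar valK. Qed.

Lemma kvar_homog k : kvar k \is 1.-homog.
Proof.
rewrite /kvar; case: insubP => [i _ _|_]; last exact: dhomog0.
by rewrite dhomogX /= mdeg1.
Qed.

(** The mapping cone of multiplication by the last variable; the sign on the second component gives
    square zero without tracking exterior degrees. *)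
Fixpoint kd r k : kos r k -> kos r k :=
  match k with
  | 0 => fun _ => 0
  | k'.+1 => fun z : kos r k' * kos r k' =>
               (kd z.1 + kvar k' *: z.2, - kd z.2)
  end.

Lemma kd_is_linear r k : linear (@kd r k).
Proof.
elim: k => [|k IH] c /=; first by move=> *; rewrite scaler0 addr0.
move=> [a b] [a' b'] /=; rewrite !IH; congr (_, _) => /=.
  rewrite !scalerDr !scalerA [kvar k * c]mulrC -!addrA; congr (_ + _).
  by rewrite addrCA.
by rewrite opprD scalerN.
Qed.
HB.instance Definition _ r k :=
  GRing.isLinear.Build S (kos r k) (kos r k) _ (@kd r k) (@kd_is_linear r k).

Lemma kd_kd r k (z : kos r k) : kd (kd z) = 0.
Proof.
elim: k z => [|k IH] //= [a b] /=; congr (_, _).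
  by rewrite linearD linearZ /= IH scalerN add0r addrN.
by rewrite linearN /= IH !oppr0.
Qed.

Fixpoint kmap r s k (A : 'M[S]_(r, s)) : kos r k -> kos s k :=
  match k with
  | 0 => fun z => z *m A
  | k'.+1 => fun z : kos r k' * kos r k' => (kmap A z.1, kmap A z.2)
  end.

Lemma kmap_is_linear r s k (A : 'M[S]_(r, s)) : linear (@kmap r s k A).
Proof.
elim: k => [|k IH] c /=; first by move=> *; rewrite mulmxDl scalemxAl.
by move=> [a b] [a' b'] /=; rewrite !IH.
Qed.
HB.instance Definition _ r s k A :=
  GRing.isLinear.Build S (kos r k) (kos s k) _ (@kmap r s k A) (@kmap_is_linear r s k A).

Lemma kd_kmap r s k (A : 'M[S]_(r, s)) (z : kos r k) :
  kd (kmap A z) = kmap A (kd z).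
Proof.
elim: k z => [|k IH] /=; first by rewrite mul0mx.
by move=> [a b] /=; rewrite !IH linearD linearZ linearN.
Qed.

(** Quotient complexes are handled through representatives: a chain vanishes modulo a submodule when
    all its coefficients lie in it. *)
Fixpoint kall r k (P : 'rV[S]_r -> Prop) : kos r k -> Prop :=
  match k with
  | 0 => P
  | k'.+1 => fun z : kos r k' * kos r k' => kall P z.1 /\ kall P z.2
  end.

Lemma kallW r k (P P' : 'rV[S]_r -> Prop) (z : kos r k) :
  (forall v, P v -> P' v) -> kall P z -> kall P' z.
Proof.
by move=> PP'; elim: k z => [|k IH] z /=; [exact: PP' | move=> [/IH ? /IH]].
Qed.

(** Coefficientwise choice of lifts. [Q] is whatever the error of a lift along [A] satisfies: lying
    in an ideal, or being zero. *)
Lemma kall_ex r s k (P : 'rV[S]_r -> 'rV[S]_s -> Prop) (z : kos r k) :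
  kall (fun v => exists w, P v w) z ->
  exists w : kos s k, forall (Q : 'rV[S]_r -> Prop) (A : 'M[S]_(s, r)),
   (forall v w, P v w -> Q (v - w *m A)) -> kall Q (z - kmap A w).
Proof.
elim: k z => [|k IH] z /=.
  by move=> [w Pw]; exists w => Q A; exact.
move=> [/IH[w1 h1] /IH[w2 h2]]; exists (w1, w2) => Q A PQ.
by split; [apply: h1 | apply: h2].
Qed.

Lemma kallD r k (P : 'rV[S]_r -> Prop) (z w : kos r k) :
  (forall u v, P u -> P v -> P (u + v)) ->
  kall P z -> kall P w -> kall P (z + w).
Proof.
move=> PD; elim: k z w => [|k IH] z w /=; first exact: PD.
by move=> [? ?] [? ?]; split; apply: IH.
Qed.

Lemma kallZ r k (P P' : 'rV[S]_r -> Prop) c (z : kos r k) :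
  (forall u, P u -> P' (c *: u)) -> kall P z -> kall P' (c *: z).
Proof.
move=> PZ; elim: k z => [|k IH] z /=; first exact: PZ.
by move=> [? ?]; split; apply: IH.
Qed.

Lemma kall_kd r k (P : 'rV[S]_r -> Prop) (z : kos r k) :
  P 0 -> (forall u v, P u -> P v -> P (u + v)) ->
  (forall c u, P u -> P (c *: u)) -> kall P z -> kall P (kd z).
Proof.
move=> P0 PD PZ; elim: k z => [|k IH] z //= [Pa Pb]; split.
  by apply: kallD; [| apply: IH | apply: kallZ Pb; apply: PZ].
by rewrite -scaleN1r; apply: kallZ (IH _ Pb); apply: PZ.
Qed.

(* Component of exterior degree 0, and its section. *)
Fixpoint kaug r k : kos r k -> 'rV[S]_r :=
  match k with
  | 0 => fun z => z
  | k'.+1 => fun z : kos r k' * kos r k' => kaug z.1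
  end.

Fixpoint kinj r k (v : 'rV[S]_r) : kos r k :=
  match k with
  | 0 => v
  | k'.+1 => (kinj k' v, 0)
  end.

Lemma kaug_is_linear r k : linear (@kaug r k).
Proof. by elim: k => [|k IH] c //= [a b] [a' b'] /=; rewrite IH. Qed.
HB.instance Definition _ r k :=
  GRing.isLinear.Build S (kos r k) 'rV[S]_r _ (@kaug r k) (@kaug_is_linear r k).

Lemma kaug_kinj r k (v : 'rV[S]_r) : kaug (kinj k v) = v.
Proof. by elim: k => //=. Qed.

Lemma kd_kinj r k (v : 'rV[S]_r) : kd (kinj k v) = 0.
Proof. by elim: k => [|k IH] //=; rewrite IH scaler0 raddf0 oppr0 addr0. Qed.

Lemma kaug_map r s k (A : 'M[S]_(r, s)) (z : kos r k) :
  kaug (kmap A z) = kaug z *m A.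
Proof. by elim: k z => //= k IH z; rewrite IH. Qed.

(* The ideal generated by the variables in V, described through supports. *)
Definition videal (V : pred 'I_N) (p : S) : Prop :=
  forall m, p@_m != 0 -> exists2 i, V i & m i != 0%N.

Lemma videal0 V : videal V 0.
Proof. by move=> m; rewrite mcoeff0 eqxx. Qed.

Lemma videalD V p q : videal V p -> videal V q -> videal V (p + q).
Proof.
move=> hp hq m; rewrite mcoeffD; have [p0|/hp//] := eqVneq (p@_m) 0.
by rewrite p0 add0r => /hq.
Qed.

Lemma videalN V p : videal V p -> videal V (- p).
Proof. by move=> hp m; rewrite mcoeffN oppr_eq0 => /hp. Qed.

Lemma videalM V p q : videal V q -> videal V (p * q).
Proof.
move=> hq m; rewrite -mcoeff_msupp => /msuppM_le/allpairsP[[m1 m2]] /= [h1 h2 ->].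
have [|i Vi mi] := hq m2; first by rewrite -mcoeff_msupp.
by exists i => //; rewrite mnmDE addn_eq0 negb_and mi orbT.
Qed.

Lemma videalX (V : pred 'I_N) i : V i -> videal V 'X_i.
Proof.
move=> Vi m; rewrite mcoeffX; have [<-|] := eqVneq U_(i)%MM m; last by rewrite eqxx.
by exists i; rewrite // mnm1E eqxx.
Qed.

Lemma videalX_reg (V : pred 'I_N) i p : ~~ V i -> videal V ('X_i * p) -> videal V p.
Proof.
move=> Vi h m pm; have [|j Vj] := h (U_(i) + m)%MM.
  by rewrite mulrC mcoeffMX.
rewrite mnmDE mnm1E; have [ij|_ mj] := eqVneq i j; first by rewrite ij Vj in Vi.
by exists j.
Qed.

Lemma videal_pred0 (V : pred 'I_N) p : V =1 xpred0 -> videal V p -> p = 0.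
Proof.
move=> V0 h; apply/mpolyP => m; rewrite mcoeff0; apply/eqP/contraT => /h[i].
by rewrite V0.
Qed.

Lemma videal_sub (V V' : pred 'I_N) p : {subset V <= V'} -> videal V p -> videal V' p.
Proof. by move=> s h m /h[i /s Vi mi]; exists i. Qed.

Lemma videal_split (V : pred 'I_N) i p : videal [predU1 i & V] p ->
  exists q, videal V (p - 'X_i * q).
Proof.
move=> h; exists (\sum_(m <- msupp p | m i != 0%N) p@_m *: 'X_[m - U_(i)]).
rewrite {1}(mpolyE p) mulr_sumr [X in _ - X]big_mkcond -sumrB big_seq.
apply: (big_ind (videal V)); [exact: videal0 | exact: videalD |] => m.
rewrite mcoeff_msupp => /h[j Vj mj].
have [mi|mi] := eqVneq (m i) 0%N; last first.
  rewrite -scalerAr -mpolyXD addmC submK ?subrr; [exact: videal0|].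
  by rewrite lep1mP.
rewrite subr0 => m'; rewrite mcoeffZ mcoeffX; have [<- _|] := eqVneq m m'; last first.
  by rewrite mulr0 eqxx.
move: Vj; rewrite inE; case: eqP => [ji|_ /= Vj]; first by rewrite ji mi in mj.
by exists j.
Qed.

Definition videalv r V (v : 'rV[S]_r) : Prop := forall j, videal V (v 0 j).
Definition below k : pred 'I_N := fun i => (i < k)%N.

Lemma videalvD r V (u v : 'rV[S]_r) : videalv V u -> videalv V v -> videalv V (u + v).
Proof. by move=> hu hv j; rewrite mxE; apply: videalD. Qed.

Lemma videal_kvar k (V : pred 'I_N) p : 
  (forall i : 'I_N, i = k :> nat -> V i) -> videal V (kvar k * p).
Proof.
move=> h; rewrite /kvar mulrC; case: insubP => [i _ ik|_]; last first.
  by rewrite mulr0; apply: videal0.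
by apply/videalM/videalX/h.
Qed.

(** In exterior degree 0 a boundary is a combination of variables; this later prevents a basis
    element from being a boundary. *)
Lemma kaug_kd r k (z : kos r k) : videalv (below k) (kaug (kd z)).
Proof.
elim: k z => [|k IH] z /=; first by move=> j; rewrite mxE; apply: videal0.
rewrite linearD linearZ /=; apply: videalvD.
  by move=> j; apply: (videal_sub _ (IH _ j)) => i; rewrite !unfold_in /below => /leqW.
by move=> j; rewrite mxE; apply: videal_kvar => i; rewrite /below => ->.
Qed.

(** The variables form a regular sequence. The condition on [kaug] kills the class in exterior
    degree 0, the only degree with homology. The induction uses that the last variable is regular
    modulo the earlier ones. *)
Lemma kos_acyclic r k (z : kos r k) : (k <= N)%N ->
  kd z = 0 -> videalv (below k) (kaug z) -> exists w, z = kd w.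
Proof.
elim: k z => [|k IH] z kN /=.
  move=> _ h; exists 0; apply/rowP => j; rewrite mxE.
  by apply: (videal_pred0 _ (h j)).
case: z => a b /= [e1 /eqP]; rewrite oppr_eq0 => /eqP e2 h.
pose x := Ordinal kN; have xE : kvar k = 'X_x by rewrite -(kvarE x).
(* Applying [kaug] to kd a + x b = 0 puts x times kaug b in the ideal of the earlier variables,
   modulo which x is regular. *)
have [|b' eb] := IH b (ltnW kN) e2.
  move=> j; apply: (@videalX_reg _ x); first by rewrite /below ltnn.
  have := @kaug_kd _ _ a j; move/eqP: e1; rewrite addr_eq0 => /eqP ->.
  by rewrite linearN linearZ /= mxE xE => /videalN; rewrite mxE opprK.
have [c hc] : exists c : 'rV[S]_r, videalv (below k) (kaug a - kvar k *: c).
  have hh j : exists q, videal (below k) (kaug a 0 j - 'X_x * q).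
    apply: videal_split; apply: (videal_sub _ (h j)) => i.
    rewrite !inE -val_eqE /= !unfold_in /below.
    by rewrite ltnS leq_eqVlt.
  have [c hc] := fin_all_exists hh.
  by exists (\row_j c j) => j; rewrite !mxE xE.
(* Chains [kinj] are cycles, so they correct exterior degree 0, here to kaug a - x c, and keep the
   cycle condition. *)
have [||a' ea] := IH (a + kvar k *: (b' - kinj k (kaug b' + c))) (ltnW kN).
- by rewrite linearD linearZ /= linearB /= kd_kinj subr0 -eb.
- rewrite linearD linearZ /= linearB /= kaug_kinj opprD addrA addrN sub0r scalerN.
  exact: hc.
exists (a', kinj k (kaug b' + c) - b') => /=; congr (_, _).
  by rewrite -ea -addrA -scalerDr addrA subrK subrr scaler0 addr0.
by rewrite linearB /= kd_kinj sub0r opprK.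
Qed.

End Koszul.

(** * Koszul homology with internal degrees *)

Section KoszulDegrees.

Variables (K : fieldType) (N : nat).
Local Notation S := {mpoly K[N]}.

Definition rproj r (sh : 'I_r -> nat) (Q : pred nat) (v : 'rV[S]_r) : 'rV[S]_r :=
  \row_b mproj (fun e => Q (e + sh b)%N) (v 0 b).

(* [Q a t] selects exterior degree a and internal degree t of the coefficient
   (the shift of the basis element of S^r included). *)
Fixpoint kproj r (sh : 'I_r -> nat) k (Q : nat -> pred nat) : kos K N r k -> kos K N r k :=
  match k with
  | 0 => rproj sh (Q 0)
  | k'.+1 => fun z : kos K N r k' * kos K N r k' =>
      (kproj sh Q z.1, kproj sh (fun a => Q a.+1) z.2)
  end.

Lemma kprojD r (sh : 'I_r -> nat) k Q :
  {morph @kproj r sh k Q : z w / z + w}.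
Proof.
elim: k Q => [|k IH] Q z w /=; last by rewrite !IH.
by apply/rowP => j; rewrite !mxE raddfD.
Qed.

Lemma kprojN r (sh : 'I_r -> nat) k Q :
  {morph @kproj r sh k Q : z / - z}.
Proof.
elim: k Q => [|k IH] Q z /=; last by rewrite !IH.
by apply/rowP => j; rewrite !mxE raddfN.
Qed.

Lemma kprojZ r (sh : 'I_r -> nat) k (Q Q' : nat -> pred nat) d (g : S)
    (z : kos K N r k) : g \is d.-homog ->
  (forall a t, Q' a (t + d)%N = Q a t) ->
  kproj sh Q' (g *: z) = g *: kproj sh Q z.
Proof.
move=> hg; elim: k Q Q' z => [|k IH] Q Q' z QQ' /=.
  apply/rowP => j; rewrite !mxE ![g * _]mulrC (mprojM _ _ hg); congr (_ * _).
  by apply: eq_mproj => e; rewrite -QQ' addnAC.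
rewrite (IH Q) // (IH (fun a => Q a.+1)) // => a t; exact: QQ'.
Qed.

(** The differential lowers the exterior degree by one and multiplies by a variable, or changes only
    a sign, so a + t is preserved. *)
Lemma kproj_kd r (sh : 'I_r -> nat) k (Q Q' : nat -> pred nat) (z : kos K N r k) :
  (forall a t, Q' a t.+1 = Q a.+1 t) ->
  kproj sh Q' (kd z) = kd (kproj sh Q z).
Proof.
elim: k Q Q' z => [|k IH] Q Q' z QQ' /=.
  by apply/rowP => j; rewrite !mxE raddf0.
rewrite kprojD kprojN (IH Q) // (IH (fun a => Q a.+1)) //.
rewrite (kprojZ (Q := fun a => Q a.+1) _ _ (kvar_homog _ _ _)) // => a t.
by rewrite addn1.
Qed.

Lemma kproj_sub r (sh : 'I_r -> nat) k (Q Q' : nat -> pred nat) (z : kos K N r k) :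
  (forall a t, Q' a t -> Q a t) ->
  kproj sh Q (kproj sh Q' z) = kproj sh Q' z.
Proof.
elim: k Q Q' z => [|k IH] Q Q' z QQ' /=.
  apply/rowP => j; rewrite !mxE mproj_comp; apply: eq_mproj => e /=.
  by apply/andb_idl/QQ'.
by rewrite !IH // => a t; apply: QQ'.
Qed.

Definition graded_mx r s (shr : 'I_r -> nat) (shs : 'I_s -> nat) (A : 'M[S]_(r, s)) :=
  forall a b, if (shs b <= shr a)%N then A a b \is (shr a - shs b)%N.-homog
              else A a b == 0.

Lemma kproj_map r s shr shs k Q (A : 'M[S]_(r, s)) (z : kos K N r k) :
  graded_mx shr shs A ->
  kproj shs Q (kmap A z) = kmap A (kproj shr Q z).
Proof.
move=> gA; elim: k Q z => [|k IH] Q z /=; last by rewrite !IH.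
apply/rowP => b; rewrite !mxE raddf_sum; apply: eq_bigr => a _ /=.
rewrite mxE; have := gA a b; case: ifP => [le hA|_ /eqP ->]; last first.
  by rewrite !mulr0 raddf0.
by rewrite (mprojM _ _ hA); congr (_ * _); apply: eq_mproj => e; rewrite -addnA subnK.
Qed.

Lemma kproj_all r (sh : 'I_r -> nat) k Q (P : 'rV[S]_r -> Prop) (z : kos K N r k) :
  (forall Q v, P v -> P (rproj sh Q v)) -> kall P z -> kall P (kproj sh Q z).
Proof.
move=> PQ; elim: k Q z => [|k IH] Q z /=; first exact: PQ.
by move=> [? ?]; split; apply: IH.
Qed.

Lemma kproj_kinj r (sh : 'I_r -> nat) k Q (v : 'rV[S]_r) :
  kproj sh Q (kinj k v) = kinj k (rproj sh (Q 0) v).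
Proof.
elim: k Q v => [|k IH] Q v //=; rewrite IH; congr (_, _).
have := kprojD sh (fun a => Q a.+1) (0 : kos K N r k) 0.
by rewrite addr0 => /eqP; rewrite -subr_eq0 opprD addNKr oppr_eq0 => /eqP.
Qed.

Lemma kaug_proj r (sh : 'I_r -> nat) k Q (z : kos K N r k) :
  kaug (kproj sh Q z) = rproj sh (Q 0) (kaug z).
Proof. by elim: k z => [|k IH] z //=; rewrite IH. Qed.

Lemma kall_aug r k (P : 'rV[S]_r -> Prop) (z : kos K N r k) : kall P z -> P (kaug z).
Proof. by elim: k z => [|k IH] z //= [/IH]. Qed.

Lemma kall_map r s k (P : 'rV[S]_s -> Prop) (A : 'M[S]_(r, s)) (z : kos K N r k) :
  kall P (kmap A z) <-> kall (fun v => P (v *m A)) z.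
Proof.
by elim: k z => [|k IH] z //=; split=> -[? ?]; split; apply/IH.
Qed.

Lemma kall_all r k (P : 'rV[S]_r -> Prop) (z : kos K N r k) : (forall v, P v) -> kall P z.
Proof. by move=> h; elim: k z => [|k IH] z //=. Qed.

Lemma kall_eq0 r k (z : kos K N r k) : kall (fun v => v = 0) z <-> z = 0.
Proof.
elim: k z => [|k IH] z //=; case: z => a b /=; split=> [[/IH-> /IH->] //|[-> ->]].
by split; apply/IH.
Qed.

Lemma videal_coef0 p : videal (below N) p <-> (p : S)@_0%MM = 0.
Proof.
split=> [h|p0 m pm].
  by apply/eqP/contraT => /h [i _]; rewrite mnm0E eqxx.
have : m != 0%MM by apply: contraNneq pm => ->; rewrite p0.
rewrite -mdeg_eq0 mdegE sum_nat_eq0 => /forallPn[i]; rewrite implyTb => mi.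
by exists i; first exact: ltn_ord.
Qed.

Lemma kmap_scalar r k c (z : kos K N r k) : kmap (c%:M) z = c *: z.
Proof. by elim: k z => [|k IH] z /=; [rewrite mul_mx_scalar | rewrite !IH]. Qed.

Record hideal (I : S -> Prop) : Prop := HIdeal {
  hideal0 : I 0;
  hidealD : forall p q, I p -> I q -> I (p + q);
  hidealM : forall r p, I p -> I (r * p);
  hideal_proj : forall Q p, I p -> I (mproj Q p)
}.

Definition icomp (I : S -> Prop) (v : 'rV[S]_1) : Prop := I (v 0 0).
Definition ksh : 'I_1 -> nat := fun=> 0%N.

(* Vanishing of the Koszul homology of S/I in internal degrees larger than
   twice the homological degree: the class of a coefficient of polynomial
   degree t in exterior degree a has internal degree a + t. *)
Definition kvanish (I : S -> Prop) : Prop :=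
  forall z : kos K N 1 N, kproj ksh (fun a t => a < t)%N z = z ->
    kall (icomp I) (kd z) -> exists w, kall (icomp I) (z - kd w).

Lemma kvanish_ext (I I' : S -> Prop) : (forall p, I p <-> I' p) ->
  kvanish I -> kvanish I'.
Proof.
move=> II' h z /h{}h hz; have [|w hw] := h; last exists w.
  by apply: kallW hz => v /II'.
by apply: kallW hw => v /II'.
Qed.

Lemma icomp_kd k I (z : kos K N 1 k) : hideal I ->
  kall (icomp I) z -> kall (icomp I) (kd z).
Proof.
case=> I0 ID IM _; apply: kall_kd; first by rewrite /icomp mxE.
  by move=> u v; rewrite /icomp mxE; exact: ID.
by move=> c u; rewrite /icomp mxE; exact: IM.
Qed.

Lemma icompD k I (z w : kos K N 1 k) : hideal I ->
  kall (icomp I) z -> kall (icomp I) w -> kall (icomp I) (z + w).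
Proof. by case=> _ ID _ _; apply: kallD => u v; rewrite /icomp mxE; exact: ID. Qed.

Lemma icompZ k I c (z : kos K N 1 k) : hideal I ->
  kall (icomp I) z -> kall (icomp I) (c *: z).
Proof. by case=> _ _ IM _; apply: kallZ => u; rewrite /icomp mxE; exact: IM. Qed.

Lemma icomp_proj k I Q (z : kos K N 1 k) : hideal I ->
  kall (icomp I) z -> kall (icomp I) (kproj ksh Q z).
Proof. by case=> _ _ _ IQ; apply: kproj_all => {}Q v; rewrite /icomp mxE; exact: IQ. Qed.

(** In exterior degree 0 the condition a < t excludes constant terms, so acyclicity applies. *)
Lemma kvanish0 : kvanish (fun p => p = 0).
Proof.
move=> z zQ dz; have [|||w ->] := @kos_acyclic K N 1 N z; first by [].
- apply/kall_eq0; apply: kallW dz => v v0; apply/rowP => j.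
  by rewrite !ord1 [LHS]v0 mxE.
- rewrite -zQ kaug_proj => j; rewrite mxE; apply/videal_coef0.
  by rewrite mcoeff_mproj mdeg0.
exists w; rewrite subrr; apply: (kallW (P := fun v => v = 0)); last exact/kall_eq0.
by move=> v ->; rewrite /icomp mxE.
Qed.

(* The long exact sequence of 0 -> S/(I : f)(-d) -> S/I -> S/(I + f) -> 0,
   chased on Koszul cycles. *)
Lemma kvanish_colon (I A C : S -> Prop) (f : S) d : (d <= 2)%N -> f \is d.-homog ->
  hideal I -> hideal A -> (forall p, A p <-> I (f * p)) ->
  (forall p, C p <-> exists q, I (p - f * q)) ->
  kvanish I -> kvanish A -> kvanish C.
Proof.
move=> d2 hf hI hA AE CE TI TA z zQ dz.
have [|y0] := @kall_ex K N 1 1 N (fun v w => I (v 0 0 - f * w 0 0)) (kd z).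
  by apply: kallW dz => v /CE[q Iq]; exists q%:M; rewrite mxE eqxx mulr1n.
move=> /(_ (icomp I) (f%:M)); rewrite kmap_scalar => hy0.
have {}hy0 : kall (icomp I) (kd z - f *: y0).
  by apply: hy0 => v w; rewrite /icomp mul_mx_scalar !mxE.
have fA k (u : kos K N 1 k) : kall (icomp A) u -> kall (icomp I) (f *: u).
  by apply: kallZ => v /AE; rewrite /icomp mxE.
have fI k (u : kos K N 1 k) : kall (icomp I) (f *: u) -> kall (icomp A) u.
  elim: k u => [|k IH] u /=; first by rewrite /icomp mxE => /AE.
  by move=> [? ?]; split; apply: IH.
have IC k (u v : kos K N 1 k) :
    kall (icomp I) u -> kall (icomp C) (u + f *: v).
  elim: k u v => [|k IH] u v /=; last by move=> [? ?]; split; apply: IH.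
  by move=> Iu; apply/CE; exists (v 0 0); rewrite !mxE addrK.
(* The ranges of kd z, of y with kd z = f y modulo I, and of w with f w in the range of z. As d <=
   2, [Q2] still implies a < t, so the vanishing for [A] applies to y. *)
pose Q' a t := (a.+2 < t)%N; pose Q2 a t := Q' a (t + d)%N; pose Q3 a t := (a < t + d)%N.
have dzQ : kproj ksh Q' (kd z) = kd z.
  by rewrite -[in RHS]zQ; apply: kproj_kd => a t; rewrite /Q'; lia.
pose y := kproj ksh Q2 y0.
have hy : kall (icomp I) (kd z - f *: y).
  have := icomp_proj Q' hI hy0; rewrite kprojD kprojN dzQ.
  by rewrite (kprojZ (Q := Q2) _ _ hf).
have Ady : kall (icomp A) (kd y).
  have := icompZ (-1) hI (icomp_kd hI hy); rewrite linearB linearZ /= kd_kd sub0r.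
  rewrite scaleN1r opprK; exact: fI.
have [|w0 hw0] := TA y _ Ady.
  by apply: kproj_sub => a t; rewrite /Q2 /Q'; lia.
pose w := kproj ksh Q3 w0.
have hw : kall (icomp A) (y - kd w).
  have := icomp_proj Q2 hA hw0; rewrite kprojD kprojN kproj_sub //.
  by rewrite (@kproj_kd _ _ _ Q3) // => a t; rewrite /Q2 /Q' /Q3; lia.
have [||v hv] := TI (z - f *: w).
- rewrite kprojD kprojN zQ (kprojZ (Q := Q3) _ _ hf) //; congr (_ - _ *: _).
  by apply: kproj_sub.
- rewrite linearB linearZ /= -[kd z](subrK (f *: y)) -addrA -scalerBr.
  by apply: icompD => //; apply: fA.
exists v; have -> : z - kd v = (z - f *: w - kd v) + f *: w by rewrite addrAC subrK.
exact: IC.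
Qed.

Lemma hideal_videal (V : pred 'I_N) : hideal (@videal K N V).
Proof.
split; [exact: videal0 | exact: videalD | move=> r p; exact: videalM |].
move=> Q p h m; rewrite mcoeff_mproj; case: ifP => [_|]; [exact: h | by rewrite eqxx].
Qed.

(** One variable is added at a time; it is regular modulo the previous ones, so the colon ideal is
    the ideal itself. *)
Lemma kvanish_videal (V : pred 'I_N) : kvanish (@videal K N V).
Proof.
apply: (@kvanish_ext (videal (mem (enum V)))) => [p|].
  by split; apply: videal_sub => i; rewrite !inE mem_enum.
elim: (enum V) => [|x s IH].
  apply: kvanish_ext kvanish0 => p; split=> [->|]; first exact: videal0.
  exact: videal_pred0.
have [xs|xs] := boolP (x \in s).
  apply: kvanish_ext IH => p; split; apply: videal_sub => i; rewrite !inE.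
    by move->; rewrite orbT.
  by case/predU1P=> [->|].
apply: (@kvanish_colon (videal (mem s)) (videal (mem s)) _ 'X_x 1 _ _ _ _ _ _ IH IH) => //.
- by rewrite dhomogX /= mdeg1.
- exact: hideal_videal.
- exact: hideal_videal.
- by move=> p; split; [exact: videalM | exact: videalX_reg].
move=> p; split=> [h|[q hq]].
  by apply: (@videal_split K N (mem s)); apply: videal_sub h => i.
rewrite -[p](subrK ('X_x * q)); apply: videalD.
  by apply: videal_sub hq => i; rewrite !inE => ->; rewrite orbT.
by rewrite mulrC; apply/videalM/videalX; rewrite /= inE eqxx.
Qed.

End KoszulDegrees.

(** * From Koszul homology to Betti numbers *)

Section MinimalResolution.

Variables (K : fieldType) (n : nat) (J : Sring K n -> Prop).
Variable F : graded_free_resolution J.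
Hypotheses (HF : minimal_resolution F) (hJ : hideal J) (TJ : kvanish J).
Local Notation N := (n + n)%N.

(* Dimension shifting: Koszul cycles modulo the syzygies im (del k). *)
Lemma kvanish_syzygy k (p j : nat) (z : kos K N (rk F k) N) :
  kproj (@shift _ _ _ F k) (fun a t => (a == p) && (t + p == j))%N z = z ->
  (2 * (p + k) < j)%N ->
  kall (fun v => exists w, v = w *m del F k) (kd z) ->
  exists w, kall (fun v => exists w, v = w *m del F k) (z - kd w).
Proof.
elim: k p z => [|k IH] p z zQ pj dz.
  (* For k = 0 the augmentation identifies F_0 modulo im (del 0) with S/J, where [kvanish]
     applies. *)
  have geps : graded_mx (@shift _ _ _ F 0) ksh (eps F).
    by move=> a b; rewrite /= subn0 !ord1; apply: eps_graded.
  have [||w hw] := TJ (z := kmap (eps F) z).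
  - rewrite -{1}zQ -(kproj_map _ _ geps) kproj_sub ?(kproj_map _ _ geps) ?zQ // => a t.
    by lia.
  - rewrite kd_kmap; apply/kall_map; apply: kallW dz => v hv.
    by rewrite /icomp; apply/exact0.
  have [|w0] := @kall_ex K N 1 (rk F 0) N
      (fun v u => J (v 0 0 - (u *m eps F) ord0 ord0)) w.
    by apply: kall_all => v; apply: eps_surj.
  move=> /(_ (icomp J) (eps F)) hw0; exists w0.
  have {}hw0 : kall (icomp J) (w - kmap (eps F) w0).
    by apply: hw0 => v u; rewrite /icomp [X in _ -> J X]mxE [X in _ -> J (_ + X)]mxE.
  apply: (kallW (P := fun v => icomp J (v *m eps F))) => [v /exact0 //|].
  apply/kall_map; rewrite linearB /= -kd_kmap.
  have -> : kmap (eps F) z - kd (kmap (eps F) w0) =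
      (kmap (eps F) z - kd w) + kd (w - kmap (eps F) w0).
    by rewrite linearB /= addrA subrK.
  by apply: icompD => //; apply: icomp_kd.
have gdel : graded_mx (@shift _ _ _ F k.+1) (@shift _ _ _ F k) (del F k) by apply: del_graded.
pose y := kmap (del F k) z.
(* Over F_k itself y is a cycle, and minimality puts its exterior degree 0 part in the maximal
   ideal, so y is a boundary. *)
have [|||v yv] := @kos_acyclic K N _ N y; first by [].
- rewrite kd_kmap; apply/kall_eq0/kall_map; apply: kallW dz => u /exactS //.
- rewrite kaug_map => b; rewrite mxE; apply: (big_ind (videal (below N))).
  + exact: videal0.
  + exact: videalD.
  by move=> a _; apply/videalM/videal_coef0/HF.
pose Q a t := (a == p.+1) && (t + p.+1 == j)%N.
pose v' := kproj (@shift _ _ _ F k) Q v.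
have yv' : kd v' = y.
  rewrite -(@kproj_kd _ _ _ _ _ Q (fun a t => (a == p) && (t + p == j)%N)); last first.
    by move=> a t; rewrite /Q; lia.
  by rewrite -yv (kproj_map _ _ gdel) zQ.
(* A cycle modulo im (del k), one exterior degree higher; p plus the index of the module, hence the
   bound on j, is unchanged. *)
have [|||w hw] := IH p.+1 v'.
- by apply: kproj_sub.
- by lia.
- by rewrite yv'; apply/kall_map/kall_all => u; exists u.
have [u hu] := @kall_ex K N _ _ N (fun v u => v = u *m del F k) _ hw.
have {}hu : v' - kd w = kmap (del F k) u.
  apply/eqP; rewrite -subr_eq0; apply/eqP/kall_eq0/hu => a b ->.
  by rewrite subrr.
exists u; apply: (kallW (P := fun v => v *m del F k = 0)) => [? /exactS //|].
apply/(kall_map (fun v => v = 0))/kall_eq0; rewrite linearB /= -kd_kmap -hu linearB /= kd_kd subr0.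
by rewrite yv' subrr.
Qed.

(** A basis vector of degree j, placed in exterior degree 0, would be a boundary plus an element of
    im (del i). In exterior degree 0 both have entries without constant term, whereas the vector has
    an entry 1. *)
Lemma betti_kvanish i j : (2 * i < j)%N -> betti F i j = 0%N.
Proof.
move=> ij; apply/eqP; rewrite cards_eq0; apply/eqP/setP => a; rewrite !inE.
apply/negbTE/negP => /eqP aj.
have [||| w /kall_aug] := @kvanish_syzygy i 0 j (kinj N (delta_mx 0 a)).
- rewrite kproj_kinj; congr kinj; apply/rowP => b; rewrite !mxE eqxx /=.
  have [->|ba] := eqVneq b a; last by rewrite raddf0.
  by rewrite (mproj_homog _ (@dhomog1 _ _ _)) /= add0n addn0 aj eqxx.
- by [].
- rewrite kd_kinj; apply: (kallW (P := fun v => v = 0)); last exact/kall_eq0.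
  by move=> v ->; exists 0; rewrite mul0mx.
- move=> [w' e]; have : (1 : Sring K n)@_0%MM = 0; last first.
    by move/eqP; rewrite mcoeff1 eqxx oner_eq0.
  have -> : (1 : Sring K n) = kaug (kd w) 0 a + (w' *m del F i) 0 a.
    by rewrite -e linearB /= kaug_kinj 3!mxE !eqxx addrCA subrr addr0.
  apply/videal_coef0/videalD; first exact: kaug_kd.
  rewrite mxE; apply: (big_ind (videal (below N))).
  + exact: videal0.
  + exact: videalD.
  by move=> b _; apply/videalM/videal_coef0/HF.
Qed.

End MinimalResolution.

(** * Binomial edge ideals *)

Section Ideals.

Variables (K : fieldType) (N : nat).
Local Notation S := {mpoly K[N]}.

Inductive ideal (G : S -> Prop) : S -> Prop :=
| ideal_zero : ideal G 0
| ideal_add p q : ideal G p -> ideal G q -> ideal G (p + q)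
| ideal_mulgen r g : G g -> ideal G (r * g).

Lemma ideal_gen (G : S -> Prop) g : G g -> ideal G g.
Proof. by move=> Gg; rewrite -[g]mul1r; constructor. Qed.

Lemma ideal_mul (G : S -> Prop) r p : ideal G p -> ideal G (r * p).
Proof.
elim=> [|{}p q _ IHp _ IHq|s g Gg]; rewrite ?mulr0 ?mulrDr ?mulrA; constructor => //.
Qed.

Lemma ideal_opp (G : S -> Prop) p : ideal G p -> ideal G (- p).
Proof. by rewrite -mulN1r; apply: ideal_mul. Qed.

Lemma ideal_sub (G : S -> Prop) p q : ideal G p -> ideal G q -> ideal G (p - q).
Proof. by move=> hp /ideal_opp; apply: ideal_add. Qed.

Lemma ideal_sum (G : S -> Prop) (I : Type) (r : seq I) (P : pred I) (F : I -> S) :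
  (forall i, P i -> ideal G (F i)) -> ideal G (\sum_(i <- r | P i) F i).
Proof. by apply: big_ind; [exact: ideal_zero | exact: ideal_add]. Qed.

Lemma ideal_scale (G : S -> Prop) (c : K) p : ideal G p -> ideal G (c *: p).
Proof. by rewrite -mul_mpolyC; apply: ideal_mul. Qed.

Lemma ideal_incl (G G' : S -> Prop) p :
  (forall g, G g -> ideal G' g) -> ideal G p -> ideal G' p.
Proof.
move=> GG'; elim=> [|{}p q _ hp _ hq|r g /GG' hg]; first exact: ideal_zero.
  exact: ideal_add.
exact: ideal_mul.
Qed.

Lemma hideal_ideal (G : S -> Prop) :
  (forall g, G g -> exists d, g \is d.-homog) -> hideal (ideal G).
Proof.
move=> hG; split; [exact: ideal_zero | exact: ideal_add | move=> r p; exact: ideal_mul |].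
move=> Q p; elim=> [|{}p q _ hp _ hq|r g Gg]; rewrite ?raddf0 ?raddfD /=.
- exact: ideal_zero.
- exact: ideal_add.
by have [d hd] := hG g Gg; rewrite (mprojM _ _ hd); constructor.
Qed.

Lemma ideal_morph (G I : S -> Prop) (h : {rmorphism S -> S}) p :
  I 0 -> (forall p q, I p -> I q -> I (p + q)) -> (forall r p, I p -> I (r * p)) ->
  (forall g, G g -> I (h g)) -> ideal G p -> I (h p).
Proof.
move=> I0 ID IM hG; elim=> [|{}p q _ hp _ hq|r g /hG hg].
- by rewrite rmorph0.
- by rewrite rmorphD; apply: ID.
by rewrite rmorphM; apply: IM.
Qed.

End Ideals.

(** * Edge ideals with deleted vertices and Ohtani's decomposition *)

Section BinomialEdgeIdeals.

Variables (K : fieldType) (n : nat).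
Local Notation S := (Sring K n).
Local Notation xv := (@xvar K n).
Local Notation yv := (@yvar K n).
Local Notation ff := (@fij K n).
Implicit Types (e : rel 'I_n) (W : {set 'I_n}).

(* [bei e W] is J_(G - W) + (x_w, y_w : w in W): deleting a vertex is encoded
   by adding its two variables to the ideal. *)
Inductive bei_gen e W : S -> Prop :=
| bei_edge i j : e i j -> bei_gen e W (ff i j)
| bei_x w : w \in W -> bei_gen e W (xv w)
| bei_y w : w \in W -> bei_gen e W (yv w).

Definition bei e W := ideal (bei_gen e W).

Lemma xvar_homog i : xv i \is 1.-homog.
Proof. by rewrite dhomogX /= mdeg1. Qed.

Lemma yvar_homog i : yv i \is 1.-homog.
Proof. by rewrite dhomogX /= mdeg1. Qed.

Lemma fij_homog i j : ff i j \is 2.-homog.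
Proof.
have M a b : xv a * yv b \is 2.-homog.
  exact: (dhomogM (xvar_homog a) (yvar_homog b)).
by apply: rpredB; exact: M.
Qed.

Lemma hideal_bei e W : hideal (bei e W).
Proof.
apply: hideal_ideal => g [i j _|w _|w _].
- by exists 2; apply: fij_homog.
- by exists 1; apply: xvar_homog.
- by exists 1; apply: yvar_homog.
Qed.

Lemma fijC i j : ff i j = - ff j i.
Proof. by rewrite /fij opprB. Qed.

Lemma bei_fij_W e W i j : i \in W -> bei e W (ff i j).
Proof.
move=> iW; apply: ideal_sub.
  by rewrite mulrC; apply/ideal_mul/ideal_gen/bei_x.
by apply/ideal_mul/ideal_gen/bei_y.
Qed.

Lemma bei_mono e e' W W' p :
  (forall i j, e i j -> i \notin W' -> j \notin W' -> e' i j) ->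
  W \subset W' -> bei e W p -> bei e' W' p.
Proof.
move=> ee' /subsetP WW'; apply: ideal_incl => g [i j eij|w /WW' ?|w /WW' ?].
- have [iW|iW] := boolP (i \in W'); first exact: bei_fij_W.
  have [jW|jW] := boolP (j \in W'); last by apply/ideal_gen/bei_edge/ee'.
  by rewrite fijC; apply/ideal_opp/bei_fij_W.
- by apply/ideal_gen/bei_x.
- by apply/ideal_gen/bei_y.
Qed.

Definition msubst (hx hy : 'I_n -> S) : S -> S :=
  comp_mpoly [tuple match split i with inl a => hx a | inr b => hy b end | i < n + n].
HB.instance Definition _ hx hy := GRing.RMorphism.on (msubst hx hy).

Lemma msubst_x hx hy i : msubst hx hy (xv i) = hx i.
Proof.
by rewrite /msubst comp_mpolyXU -tnth_nth tnth_mktuple (unsplitK (inl i)).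
Qed.

Lemma msubst_y hx hy i : msubst hx hy (yv i) = hy i.
Proof.
by rewrite /msubst comp_mpolyXU -tnth_nth tnth_mktuple (unsplitK (inr i)).
Qed.

Lemma msubst_fij hx hy i j : msubst hx hy (ff i j) = hx i * hy j - hx j * hy i.
Proof. by rewrite /fij rmorphB !rmorphM /= !msubst_x !msubst_y. Qed.

Lemma msubst_C hx hy c : msubst hx hy c%:MP = c%:MP.
Proof. exact: comp_mpolyC. Qed.

Lemma msubst_mnm hx hy m : msubst hx hy 'X_[m] =
  (\prod_i hx i ^+ m (lshift n i)) * (\prod_i hy i ^+ m (rshift n i)).
Proof.
rewrite /msubst comp_mpolyX big_split_ord /=; congr (_ * _); apply: eq_bigr => i _;
  rewrite tnth_mktuple.
- by rewrite (unsplitK (inl i)).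
- by rewrite (unsplitK (inr i)).
Qed.

Lemma mnm_prod m : 'X_[m] =
  (\prod_i xv i ^+ m (lshift n i)) * (\prod_i yv i ^+ m (rshift n i)) :> S.
Proof. by rewrite mpolyXE_id big_split_ord. Qed.

(** Congruence modulo [I] respects sums and products, so checking variables suffices. [I] will be an
    annihilator modulo [bei], or a kernel. *)
Lemma msubst_sub (I : S -> Prop) hx hy : I 0 ->
  (forall p q, I p -> I q -> I (p + q)) -> (forall r p, I p -> I (r * p)) ->
  (forall i, I (xv i - hx i)) -> (forall i, I (yv i - hy i)) ->
  forall p, I (p - msubst hx hy p).
Proof.
move=> I0 ID IM Ix Iy p.
have CM a b a' b' : I (a - a') -> I (b - b') -> I (a * b - a' * b').
  move=> ha hb; have -> : a * b - a' * b' = b * (a - a') + a' * (b - b') by ring.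
  by apply: ID; apply: IM.
have CX a a' k : I (a - a') -> I (a ^+ k - a' ^+ k).
  by move=> ha; elim: k => [|k IH]; rewrite ?expr0 ?subrr ?exprS //; apply: CM.
have CP (F F' : 'I_n -> S) : (forall i, I (F i - F' i)) -> I (\prod_i F i - \prod_i F' i).
  move=> h; apply: (big_ind2 (fun a b => I (a - b))) => [|a a' b b'|i _]; last exact: h.
    by rewrite subrr.
  exact: CM.
rewrite [X in msubst hx hy X](mpolyE p) [X in I (X - _)](mpolyE p) rmorph_sum.
rewrite -sumrB; apply: (big_ind I) => // m _.
rewrite -!mul_mpolyC rmorphM /= msubst_C -mulrBr; apply: IM.
by rewrite msubst_mnm mnm_prod; apply: CM; apply: CP => i; apply: CX.
Qed.

Definition kill w : S -> S :=
  msubst (fun i => if i == w then 0 else xv i) (fun i => if i == w then 0 else yv i).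
HB.instance Definition _ w := GRing.RMorphism.on (kill w).

Lemma kill_fij w i j : kill w (ff i j) = if (i == w) || (j == w) then 0 else ff i j.
Proof.
rewrite /kill msubst_fij; case: eqP => _; case: eqP => _ /=;
  by rewrite ?(mulr0, mul0r, subr0) // ?subrr.
Qed.

Lemma bei_kill e W w p : bei e (w |: W) p -> bei e W (kill w p).
Proof.
apply: ideal_morph; [exact: ideal_zero | exact: ideal_add | by move=> *; exact: ideal_mul |].
move=> g [i j eij|i|i]; first 1 last.
- rewrite /= in_setU1 /kill msubst_x; case: eqP => [_ _|_ iW]; first exact: ideal_zero.
  by apply/ideal_gen/bei_x.
- rewrite /= in_setU1 /kill msubst_y; case: eqP => [_ _|_ iW]; first exact: ideal_zero.
  by apply/ideal_gen/bei_y.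
rewrite /= kill_fij; case: ifP => _; first exact: ideal_zero.
by apply/ideal_gen/bei_edge.
Qed.

Definition fill e w : rel 'I_n := fun a b => e a b || [&& e w a, e w b & a != b].

Lemma sym_fill e w : ssrbool.symmetric e -> ssrbool.symmetric (fill e w).
Proof. by move=> se a b; rewrite /fill se eq_sym [e w a && _]andbCA. Qed.

Lemma irr_fill e w : ssrbool.irreflexive e -> ssrbool.irreflexive (fill e w).
Proof. by move=> ie a; rewrite /fill ie eqxx !andbF. Qed.

(** Expansion of a 3 by 3 determinant with a repeated row. It makes x_w kill f_ab modulo the ideal
    when a and b are neighbours of w. *)
Lemma mul_fij_x w a b : xv w * ff a b = xv a * ff w b - xv b * ff w a.
Proof. by rewrite /fij; ring. Qed.

Lemma mul_fij_y w a b : yv w * ff a b = yv a * ff w b - yv b * ff w a.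
Proof. by rewrite /fij; ring. Qed.

(** Modulo the ideal x_w and y_w annihilate f_ab, so its multiplier may be stripped of both
    variables. *)
Lemma bei_kill_sub e W w a b r : e w a -> e w b ->
  bei e W ((r - kill w r) * ff a b).
Proof.
move=> wa wb.
have fa : bei e W (ff w a) by apply/ideal_gen/bei_edge.
have fb : bei e W (ff w b) by apply/ideal_gen/bei_edge.
apply: (@msubst_sub (fun q => bei e W (q * ff a b))).
- by rewrite mul0r; apply: ideal_zero.
- by move=> p q; rewrite mulrDl; apply: ideal_add.
- by move=> s p; rewrite -mulrA; apply: ideal_mul.
- move=> i; case: eqP => [->|_]; last by rewrite subrr mul0r; apply: ideal_zero.
  by rewrite subr0 mul_fij_x; apply: ideal_sub; apply: ideal_mul.
- move=> i; case: eqP => [->|_]; last by rewrite subrr mul0r; apply: ideal_zero.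
  by rewrite subr0 mul_fij_y; apply: ideal_sub; apply: ideal_mul.
Qed.

(* Ohtani's decomposition.  The new generators f_ab of the first ideal are
   killed by x_w and y_w modulo bei e W, so modulo bei e W an element of it may
   be taken free of x_w and y_w; then setting x_w = y_w = 0 does not change it
   and sends the second ideal into bei e W. *)
Lemma ohtani e W w p : ssrbool.irreflexive e ->
  bei (fill e w) W p -> bei e (w |: W) p -> bei e W p.
Proof.
move=> ie h1 h2; have [r hr kr] : exists2 r, bei e W (p - r) & kill w r = r.
  elim: h1 => [|{h2}p q _ [r hr kr] _ [s hs ks]|r g [i j|i iW|i iW]].
  - by exists 0; [rewrite subrr; apply: ideal_zero | rewrite rmorph0].
  - exists (r + s); last by rewrite rmorphD /= kr ks.
    by rewrite opprD addrACA; apply: ideal_add.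
  - case/orP=> [eij|/and3P[wi wj _]].
      by exists 0; rewrite ?rmorph0 // subr0; apply/ideal_mulgen/bei_edge.
    exists (kill w r * ff i j); first by rewrite -mulrBl; apply: bei_kill_sub.
    rewrite rmorphM /= kill_fij.
    have -> : (i == w) = false by apply: contraTF wi => /eqP->; rewrite ie.
    have -> : (j == w) = false by apply: contraTF wj => /eqP->; rewrite ie.
    (* Idempotence of [kill w], obtained from [msubst_sub] applied to its kernel. *)
    congr (_ * _); apply/eqP; rewrite eq_sym -subr_eq0; apply/eqP.
    have kk a : kill w a - kill w (kill w a) = kill w (a - kill w a) by rewrite rmorphB.
    rewrite kk; apply: (@msubst_sub (fun q => kill w q = 0)); rewrite ?rmorph0 //.
    + by move=> a b ha hb; rewrite rmorphD /= ha hb addr0.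
    + by move=> a b hb; rewrite rmorphM /= hb mulr0.
    + move=> a; case: (eqVneq a w) => [->|_]; last by rewrite subrr rmorph0.
      by rewrite subr0 /kill msubst_x eqxx.
    + move=> a; case: (eqVneq a w) => [->|_]; last by rewrite subrr rmorph0.
      by rewrite subr0 /kill msubst_y eqxx.
  - by exists 0; rewrite ?rmorph0 // subr0; apply/ideal_mulgen/bei_x.
  - by exists 0; rewrite ?rmorph0 // subr0; apply/ideal_mulgen/bei_y.
have hpr : bei e W (p - (p - r)) by rewrite subKr -kr; apply: bei_kill;
  rewrite -[r](subKr p); apply: ideal_sub => //; apply: bei_mono hr => //; apply: subsetUr.
by rewrite -[p](subrK (p - r)); apply: ideal_add.
Qed.

End BinomialEdgeIdeals.

(** * Disjoint unions of cliques as kernels of monomial maps *)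

Lemma mpolyXU_neq0 (K : fieldType) N (i : 'I_N) : ('X_i : {mpoly K[N]}) != 0.
Proof.
apply/eqP => /(congr1 (mcoeff U_(i)%MM))/eqP.
by rewrite mcoeffXU eqxx mcoeff0 oner_eq0.
Qed.

Lemma mpolyXU_inj (K : fieldType) N : injective (fun i : 'I_N => ('X_i : {mpoly K[N]})).
Proof.
move=> i j /(congr1 (mcoeff U_(i)%MM))/eqP; rewrite !mcoeffXU eqxx.
by case: (eqVneq j i) => // _; rewrite mulr1n mulr0n oner_eq0.
Qed.

Lemma sum_delta (I : finType) (j : I) (F : I -> nat) :
  (\sum_i (i == j) * F i = F j)%N.
Proof. by rewrite (bigD1 j) //= eqxx mul1n big1 ?addn0 // => i /negPf ->. Qed.

Lemma eq_sum_leq (I : finType) (P : pred I) (F G : I -> nat) i : P i ->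
  (\sum_(j | P j) F j = \sum_(j | P j) G j)%N ->
  (forall j, P j -> j != i -> F j <= G j)%N -> (G i <= F i)%N.
Proof.
move=> Pi E FG; rewrite leqNgt; apply/negP => lt.
suff : (\sum_(j | P j) F j < \sum_(j | P j) G j)%N by rewrite E ltnn.
rewrite (bigD1 i) // [X in (_ < X)%N](bigD1 i) //= -addSn; apply: leq_add => //.
by apply: leq_sum => j /andP[]; apply: FG.
Qed.

Section ClusterGraph.

Variables (K : fieldType) (n : nat) (e : rel 'I_n) (W : {set 'I_n}) (c : 'I_n -> 'I_n).
Local Notation S := (Sring K n).
Local Notation xv := (@xvar K n).
Local Notation yv := (@yvar K n).
Local Notation ff := (@fij K n).
Local Notation l := (lshift n).
Local Notation r := (rshift n).
Implicit Types m : 'X_{1..n + n}.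

(* x_i |-> t_(c i) s_i and y_i |-> s_i: the kernel of this monomial map into a
   domain is bei e W when the connected components of the graph outside W are
   the fibres of c and are cliques. *)
Definition segre : S -> S :=
  msubst (fun i => if i \in W then 0 else 'X_(l (c i)) * 'X_(r i))
         (fun i => if i \in W then 0 else 'X_(r i)).
HB.instance Definition _ := GRing.RMorphism.on segre.

Definition segre_mnm m : 'X_{1..n + n} :=
  (\sum_i (U_(l (c i)) + U_(r i)) *+ m (l i) + \sum_i U_(r i) *+ m (r i))%MM.

Definition avoid m := [forall i in W, (m (l i) == 0%N) && (m (r i) == 0%N)].

Lemma avoidP m i : avoid m -> i \in W -> m (l i) = 0%N /\ m (r i) = 0%N.
Proof. by move=> /forallP /(_ i) /implyP h /h /andP[/eqP-> /eqP->]. Qed.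

Lemma segreX m : segre 'X_[m] = if avoid m then 'X_[segre_mnm m] else 0.
Proof.
rewrite /segre msubst_mnm; case: ifPn => [am|].
  rewrite /segre_mnm mpolyXD -!mprodXE; congr (_ * _); apply: eq_bigr => i _;
    rewrite -mpolyXn ?mpolyXD; case: ifP => // /(avoidP am)[e1 e2];
    by rewrite ?e1 ?e2 !expr0.
case/forallPn=> i; rewrite negb_imply negb_and => /andP[iW /orP[mi|mi]].
  by rewrite (bigD1 i) //= iW expr0n (negPf mi) !mul0r.
by rewrite [X in _ * X](bigD1 i) //= iW expr0n (negPf mi) !mul0r mulr0.
Qed.

Lemma segreZ (a : K) p : segre (a *: p) = a *: segre p.
Proof. by rewrite -!mul_mpolyC rmorphM /= /segre msubst_C. Qed.

Lemma segre_mnm_r m i : segre_mnm m (r i) = (m (l i) + m (r i))%N.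
Proof.
rewrite mnmDE !mnm_sumE; congr addn.
  rewrite -[RHS](sum_delta i (fun i => m (l i))); apply: eq_bigr => j _.
  by rewrite mulmnE mnmDE !mnm1E eq_lrshift eq_rshift.
rewrite -[RHS](sum_delta i (fun i => m (r i))); apply: eq_bigr => j _.
by rewrite mulmnE !mnm1E eq_rshift.
Qed.

Lemma segre_mnm_l m a : segre_mnm m (l a) = (\sum_(i | c i == a) m (l i))%N.
Proof.
rewrite mnmDE !mnm_sumE [X in (_ + X)%N]big1 ?addn0 => [|i _]; last first.
  by rewrite mulmnE mnm1E eq_rlshift.
rewrite [RHS]big_mkcond; apply: eq_bigr => j _.
by rewrite mulmnE mnmDE !mnm1E eq_rlshift eq_lshift addn0; case: eqP => _; rewrite ?mul1n ?mul0n.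
Qed.

Hypothesis clique : forall i j, i \notin W -> j \notin W -> c i = c j -> i != j -> e i j.

Lemma avoid_notin m i : avoid m -> (m (l i) != 0%N) || (m (r i) != 0%N) -> i \notin W.
Proof.
by move=> am; apply: contraTN => /(avoidP am)[-> ->].
Qed.

(* Two monomials in the same fibre are connected by moves x_i y_j -> x_j y_i. *)
Lemma bei_mnm_congr m m' : avoid m -> avoid m' -> segre_mnm m = segre_mnm m' ->
  bei e W ('X_[m] - 'X_[m'] : S).
Proof.
move=> am am' kmm'.
have H1 a : (m (l a) + m (r a) = m' (l a) + m' (r a))%N by rewrite -!segre_mnm_r kmm'.
have H2 a : (\sum_(i | c i == a) m (l i) = \sum_(i | c i == a) m' (l i))%N.
  by rewrite -!segre_mnm_l kmm'.
have am'0 i : (m' (l i) != 0%N) -> i \notin W.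
  by move=> h; apply: (avoid_notin am'); rewrite h.
have {am kmm'} amN i : (m (l i) != 0%N) -> i \notin W.
  by move=> h; apply: (avoid_notin am); rewrite h.
(* Without an excess in the x exponents, equal sums over the fibres of [c] force equality; the y
   exponents follow from the vertex degrees. *)
have eq_mnm m1 : (forall a, m1 (l a) + m1 (r a) = m' (l a) + m' (r a))%N ->
    (forall a, \sum_(i | c i == a) m1 (l i) = \sum_(i | c i == a) m' (l i))%N ->
    (forall i, ~~ (m' (l i) < m1 (l i))%N) -> m1 = m'.
  move=> H1' H2' h; have ml i : m1 (l i) = m' (l i).
    apply/eqP; rewrite eqn_leq leqNgt h /=.
    apply: (@eq_sum_leq _ (fun j => c j == c i) _ _ i (eqxx _) (H2' (c i))) => j _ _.
    by rewrite leqNgt.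
  apply/mnmP => a; case: (split_ordP a) => b -> //.
  by have := H1' b; rewrite ml => /addnI.
move: {2}(\sum_i (m (l i) - m' (l i)))%N (leqnn (\sum_i (m (l i) - m' (l i)))%N) => k.
elim: k m H1 H2 amN => [|k IH] m H1 H2 amN Dk;
    (have [/existsP[i mi]|] := boolP [exists i, (m' (l i) < m (l i))%N]; last first);
    try (rewrite negb_exists => /forallP h; have -> : m = m';
      [|by rewrite subrr; apply: ideal_zero]).
- exact: eq_mnm.
- by move: Dk; rewrite (bigD1 i) //=; lia.
- exact: eq_mnm.
(* A deficit at some j of the same clique compensates the excess at i; y_j divides m because the
   degrees at j agree. *)
- have [j /eqP cj mj] : exists2 j, c j == c i & (m (l j) < m' (l j))%N.
    apply/exists_inP/contraT; rewrite negb_exists_in => /forall_inP h.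
    have H2i := esym (H2 (c i)).
    move: mi; rewrite ltnNge (@eq_sum_leq _ (fun j => c j == c i) _ _ i (eqxx _) H2i) //.
    move=> j cj _; by rewrite leqNgt h.
  have ij : i != j by apply: contraTneq mj => <-; rewrite -leqNgt ltnW.
  have iW : i \notin W by apply: amN; lia.
  have jW : j \notin W by apply: am'0; lia.
  pose m0 := (m - (U_(l i) + U_(r j)))%MM.
  have mE : m = (m0 + (U_(l i) + U_(r j)))%MM.
    rewrite submK //; apply/mnm_lepP => a; rewrite mnmDE !mnm1E.
    case: (split_ordP a) => b ->; rewrite ?(eq_lshift, eq_rshift, eq_lrshift, eq_rlshift).
      by rewrite addn0; have [<-|_] := eqVneq i b => //=; lia.
    by rewrite add0n; have [<-|_] := eqVneq j b => //=; have := H1 j; lia.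
  (* The move x_i y_j -> x_j y_i subtracts a multiple of f_ij and lowers the total excess of m over
     m'. *)
  pose m1 := (m0 + (U_(l j) + U_(r i)))%MM.
  have m1l a : (m1 (l a) + (i == a) = m (l a) + (j == a))%N.
    rewrite mE /m1 !mnmDE !mnm1E ?(eq_lshift, eq_rshift, eq_lrshift, eq_rlshift).
    by rewrite !addn0 addnAC.
  have m1r a : (m1 (r a) + (j == a) = m (r a) + (i == a))%N.
    rewrite mE /m1 !mnmDE !mnm1E ?(eq_lshift, eq_rshift, eq_lrshift, eq_rlshift).
    by rewrite !add0n addnAC.
  have sd a (P : pred 'I_n) : (\sum_(b | P b) (a == b) = P a)%N.
    rewrite big_mkcond -[RHS](sum_delta a (fun b => P b : nat)).
    by apply: eq_bigr => b _; rewrite eq_sym; case: eqVneq => [->|]; case: (P _).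
  rewrite -['X_[m]](subrK 'X_[m1]) -addrA; apply: ideal_add.
    have -> : 'X_[m] - 'X_[m1] = 'X_[m0] * ff i j.
      by rewrite mE /m1 !mpolyXD -mulrBr.
    by apply/ideal_mulgen/bei_edge/clique.
  apply: IH.
  - by move=> a; have := H1 a; have := m1l a; have := m1r a; lia.
  - move=> a; rewrite -H2.
    have : (\sum_(b | c b == a) (m1 (l b) + (i == b)) =
            \sum_(b | c b == a) (m (l b) + (j == b)))%N.
      by apply: eq_bigr => b _; rewrite m1l.
    by rewrite !big_split !sd /= cj => /addIn.
  - move=> a ma; have := m1l a; have [<-//|] := eqVneq j a => _.
    by rewrite addn0 => E; apply: amN; lia.
  rewrite -ltnS; apply: leq_trans Dk.
  rewrite -addn1 (_ : 1 = \sum_b (i == b))%N; last by rewrite sd.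
  rewrite -big_split /=; apply: leq_sum => b _.
  have := m1l b; have [<-|ib] := eqVneq i b; first by rewrite eq_sym (negPf ij); lia.
  by have [<-|jb] := eqVneq j b; lia.
Qed.

(** Induction on the number of terms. The leading monomial either involves a vertex of [W], or its
    image cancels against that of another monomial of p, congruent to it modulo the ideal;
    subtracting shortens p. *)
Lemma segre_ker p : segre p = 0 -> bei e W p.
Proof.
move: {2}(size (msupp p)) (leqnn (size (msupp p))) => k.
elim: k p => [|k IH] p sp p0.
  by move: sp; rewrite leqn0 size_eq0 msupp_eq0 => /eqP->; apply: ideal_zero.
have [->|pn0] := eqVneq p 0; first exact: ideal_zero.
have := mlead_supp pn0; set m := mlead p => mp.
have step q : bei e W q -> segre q = 0 -> (p - q)@_m = 0 ->
    (forall m', p@_m' = 0 -> q@_m' = 0) -> bei e W p.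
  move=> hq q0 pqm qp; rewrite -[p](subrK q); apply: ideal_add => //; apply: IH.
    rewrite -ltnS; apply: leq_trans sp.
    apply: (@uniq_leq_size _ (m :: msupp (p - q)) (msupp p)).
      by rewrite /= msupp_uniq mcoeff_msupp pqm eqxx.
    move=> m'; rewrite inE => /predU1P[-> //|]; rewrite !mcoeff_msupp mcoeffB.
    by apply: contraNneq => pm'; rewrite pm' (qp _ pm') subrr.
  by rewrite rmorphB /= p0 q0 subrr.
have [am|] := boolP (avoid m); last first.
  move=> am; apply: (step (p@_m *: 'X_[m])).
  - apply: ideal_scale; move: am => /forallPn[i]; rewrite negb_imply negb_and.
    case/andP=> iW mi.
    have [k' mk' hk'] : exists2 k', m k' != 0%N & bei e W ('X_k' : S).
      case/orP: mi => mi; [exists (l i) | exists (r i)] => //.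
        by apply/ideal_gen/bei_x.
      by apply/ideal_gen/bei_y.
    by rewrite -(@submK _ U_(k') m) ?lep1mP // mpolyXD; apply: ideal_mul.
  - by rewrite segreZ segreX (negPf am) scaler0.
  - by rewrite mcoeffB mcoeffZ mcoeffX eqxx mulr1 subrr.
  move=> m' pm'; rewrite mcoeffZ mcoeffX; case: eqP => [mm'|_]; last by rewrite mulr0.
  by rewrite mm' pm' mul0r.
have [/hasP[m' m'p /and3P[m'm am' /eqP km']]|no] :=
    boolP (has (fun m' => [&& m' != m, avoid m' & segre_mnm m' == segre_mnm m]) (msupp p)).
  apply: (step (p@_m *: ('X_[m] - 'X_[m']))).
  - by apply/ideal_scale/bei_mnm_congr.
  - by rewrite segreZ rmorphB /= !segreX am am' km' subrr scaler0.
  - by rewrite mcoeffB mcoeffZ mcoeffB !mcoeffX eqxx (negPf m'm) subr0 mulr1 subrr.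
  move=> a pa; rewrite mcoeffZ mcoeffB !mcoeffX.
  have -> : (m == a) = false by apply: contraTF mp => /eqP->; rewrite mcoeff_msupp pa eqxx.
  have -> : (m' == a) = false by apply: contraTF m'p => /eqP->; rewrite mcoeff_msupp pa eqxx.
  by rewrite subrr mulr0.
(* Otherwise no other term of p reaches the image of m, whose coefficient in [segre p] is then p@_m,
   which is nonzero. *)
have := mp; rewrite mcoeff_msupp => /eqP[]; move: p0.
rewrite [in segre p](mpolyE p) rmorph_sum => /(congr1 (mcoeff (segre_mnm m))).
rewrite mcoeff0 raddf_sum (bigD1_seq m) ?msupp_uniq //= big_seq_cond big1 => [|m' /andP[m'p m'm]].
  by rewrite addr0 segreZ segreX am mcoeffZ mcoeffX eqxx mulr1.
rewrite segreZ segreX mcoeffZ.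
case: ifP => am'; last by rewrite mcoeff0 mulr0.
rewrite mcoeffX; case: eqP => [km|_]; last by rewrite mulr0.
by case/hasP: no; exists m' => //; rewrite m'm am' km eqxx.
Qed.

Lemma segre_bei p : (forall i j, i \notin W -> j \notin W -> e i j -> c i = c j) ->
  bei e W p -> segre p = 0.
Proof.
move=> ce; apply: (@ideal_morph _ _ _ (fun q => q = 0)) => //.
- by move=> a b -> ->; rewrite addr0.
- by move=> a b ->; rewrite mulr0.
move=> g [i j eij|w wW|w wW]; rewrite /= /segre ?msubst_fij ?msubst_x ?msubst_y ?wW //.
case: ifPn => iW; first by rewrite mul0r mulr0 subrr.
case: ifPn => jW; first by rewrite mul0r mulr0 subrr.
by rewrite (ce i j) //; ring.
Qed.

Lemma segre_fij u v : u \notin W -> v \notin W -> c u != c v -> segre (ff u v) != 0.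
Proof.
move=> uW vW cuv; rewrite /segre msubst_fij (negPf uW) (negPf vW).
have -> : 'X_(l (c u)) * 'X_(r u) * 'X_(r v) - 'X_(l (c v)) * 'X_(r v) * 'X_(r u) =
    'X_(r u) * 'X_(r v) * ('X_(l (c u)) - 'X_(l (c v))) :> S by ring.
rewrite !mulf_neq0 ?mpolyXU_neq0 // subr_eq0 (inj_eq (@mpolyXU_inj K _)).
by rewrite (inj_eq (@lshift_inj _ _)).
Qed.

(** The ideal is the kernel of a map to a domain, hence prime, and the image s_u s_v (t_(c u) - t_(c
    v)) of f_uv is nonzero. *)
Lemma cluster_regular u v p : u \notin W -> v \notin W -> c u != c v ->
  (forall i j, i \notin W -> j \notin W -> e i j -> c i = c j) ->
  bei e W (p * ff u v) -> bei e W p.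
Proof.
move=> uW vW cuv ce /(segre_bei ce); rewrite rmorphM /= => /eqP.
by rewrite mulf_eq0 (negPf (segre_fij uW vW cuv)) orbF => /eqP/segre_ker.
Qed.

End ClusterGraph.

(** * The colon ideal by an edge and induction along an elimination ordering *)

Section Colon.

Variables (K : fieldType) (n : nat).
Local Notation S := (Sring K n).
Local Notation xv := (@xvar K n).
Local Notation yv := (@yvar K n).
Local Notation ff := (@fij K n).
Local Notation l := (lshift n).
Local Notation r := (rshift n).
Implicit Types (e : rel 'I_n) (W : {set 'I_n}).

(* Ohtani's decomposition at a non-simplicial vertex adds edges or deletes a
   vertex; it keeps u simplicial and v isolated, and ends at a disjoint union of
   cliques. *)
Lemma bei_regular e W u v (p : S) : ssrbool.symmetric e -> ssrbool.irreflexive e ->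
  u \notin W -> v \notin W -> u != v ->
  (forall a b, a \notin W -> b \notin W -> e u a -> e u b -> a != b -> e a b) ->
  (forall a, a \notin W -> ~~ e v a) ->
  bei e W (p * ff u v) -> bei e W p.
Proof.
(* The measure counts non-adjacent pairs and vertices outside [W]: completing a neighbourhood lowers
   the first, deleting a vertex the second. *)
move: {2}(#|[set ab : 'I_n * 'I_n | ~~ e ab.1 ab.2]| + #|~: W|)%N
  (leqnn (#|[set ab : 'I_n * 'I_n | ~~ e ab.1 ab.2]| + #|~: W|)%N) => k.
elim: k e W => [|k IH] e W hk se ie uW vW uv su iv hp.
  by move: hk; rewrite (cardD1 u (mem (~: W))) !inE uW addnS.
have [/existsP[w /existsP[a /existsP[b /and5P[wW /andP[aW bW] wa wb /andP[ab nab]]]]]|no] :=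
  boolP [exists w, exists a, exists b, [&& w \notin W, (a \notin W) && (b \notin W),
    e w a, e w b & (a != b) && ~~ e a b]].
  have wu : u != w by apply: contraNneq nab => uw; apply: su; rewrite // uw.
  have wv : v != w by apply: contraTneq wa => <-; apply: iv.
  have vw : e w v = false by rewrite se; apply/negbTE/iv.
  apply: (@ohtani _ _ _ _ w) => //; apply: IH => //.
  - rewrite -ltnS; apply: leq_trans hk; rewrite ltn_add2r; apply: proper_card.
    apply/properP; split; last by exists (a, b); rewrite !inE /= /fill ?wa ?wb ?ab ?orbT.
    by apply/subsetP => -[x y]; rewrite !inE /= /fill negb_or => /andP[].
  - exact: sym_fill.
  - exact: irr_fill.
  - move=> x y xW yW; rewrite /fill => ux uy xy; rewrite xy andbT.
    case/orP: ux => [ux|/and3P[eu wx _]]; case/orP: uy => [uy|/and3P[wu' wy _]].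
    + by rewrite su.
    + have [->|xw] := eqVneq x w; first by rewrite wy.
      by rewrite wy andbT [e w x]se (su x w) ?orbT // se.
    + have [->|yw] := eqVneq y w; first by rewrite [e x w]se wx.
      by rewrite wx /= [e w y]se (su y w) ?orbT // se.
    + by rewrite wx wy orbT.
  - by move=> x xW; rewrite /fill vw /= orbF iv.
  - by apply: bei_mono hp => // i j eij _ _; rewrite /fill eij.
  - rewrite -ltnS; apply: leq_trans hk; rewrite ltn_add2l; apply: proper_card.
    rewrite properC; apply/properP; split; first exact: subsetUr.
    by exists w; rewrite ?setU11.
  - by rewrite !inE negb_or wu.
  - by rewrite !inE negb_or wv.
  - by move=> x y; rewrite !inE !negb_or => /andP[_ xW] /andP[_ yW]; apply: su.
  - by move=> x; rewrite !inE negb_or => /andP[_ /iv].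
  - by apply: bei_mono hp => //; apply: subsetUr.
(* With every vertex simplicial, adjacency is transitive on distinct vertices, so the components
   outside [W] are cliques. *)
have trans w a b : w \notin W -> a \notin W -> b \notin W -> e w a -> e w b -> a != b -> e a b.
  move=> wW aW bW wa wb ab; apply: contraNT no => nab; apply/existsP; exists w.
  by apply/existsP; exists a; apply/existsP; exists b; rewrite wW aW bW wa wb ab nab.
(* For i outside [W] this is its component; picking from the set makes the representative depend on
   the component only. *)
pose C i := [set j | (j \notin W) && ((i == j) || e i j)].
pose c i := odflt i [pick j in C i].
have CE i j : i \notin W -> j \notin W -> e i j -> C i = C j.
  have sub a b : a \notin W -> b \notin W -> e a b -> C a \subset C b.
    move=> aW bW ab; apply/subsetP => x; rewrite !inE => /andP[xW].
    rewrite xW /= => /predU1P[<-|ax]; first by rewrite [e b a]se ab orbT.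
    by have [//|bx] := eqVneq b x; apply: (trans a).
  move=> iW jW ij; apply/eqP; rewrite eqEsubset !sub // se //.
have cC i : i \notin W -> c i \in C i.
  by move=> iW; rewrite /c; case: pickP => [//|/(_ i)]; rewrite !inE iW eqxx.
apply: (@cluster_regular K n e W c _ u v) hp => //.
- move=> i j iW jW cij ij; have := cC i iW; rewrite inE => /andP[kW].
  have := cC j jW; rewrite inE -cij => /andP[_].
  case/predU1P=> [<-|jk]; case/predU1P=> [ik|ik].
  + by rewrite ik eqxx in ij.
  + by [].
  + by rewrite ik se.
  by apply: (trans (c i)); rewrite // se.
- apply/eqP => cuv; have := cC v vW; rewrite inE => /andP[kW /predU1P[vk|]]; last first.
    by rewrite (negPf (iv _ kW)).
  have := cC u uW; rewrite inE cuv -vk vW /= (negPf uv) /= se.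
  by rewrite (negPf (iv _ uW)).
by move=> i j iW jW /(CE i j iW jW) Cij; rewrite /c Cij; case: pickP => // /(_ i);
  rewrite -Cij inE iW eqxx.
Qed.

(** Here [e] is the graph without the edge uv. Determinantal identities show that f_uv multiplies
    each generator of the left ideal into [bei e W]; conversely the left ideal contains [bei e W],
    and f_uv is regular modulo it. *)
Lemma bei_colon e W u v (p : S) : ssrbool.symmetric e -> ssrbool.irreflexive e ->
  u \notin W -> v \notin W -> u != v -> ~~ e u v ->
  (forall w, w \notin W -> e v w -> e u w) ->
  bei (fill e u) (W :|: [set w | e v w]) p <-> bei e W (ff u v * p).
Proof.
move=> se ie uW vW uv nuv sv; split.
  elim=> [|{}p q _ hp _ hq|s g hg].
  - by rewrite mulr0; apply: ideal_zero.
  - by rewrite mulrDr; apply: ideal_add.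
  rewrite mulrCA; apply: ideal_mul.
  have mulgen a b : e u a -> e u b -> bei e W (ff u v * ff a b).
    move=> ua ub; have -> : ff u v * ff a b = ff a v * ff u b - ff b v * ff u a.
      by rewrite /fij; ring.
    by apply: ideal_sub; apply/ideal_mulgen/bei_edge.
  case: hg => [i j /orP[ij|/and3P[ui uj _]]|w|w].
  - by apply/ideal_mulgen/bei_edge.
  - exact: mulgen.
  - rewrite !inE; have [wW _|wW /= vw] := boolP (w \in W).
      by apply/ideal_mulgen/bei_x.
    have -> : ff u v * xv w = - (xv u * ff v w) + xv v * ff u w by rewrite /fij; ring.
    by apply: ideal_add;
      [apply: ideal_opp|]; apply/ideal_mulgen/bei_edge => //; apply: sv.
  - rewrite !inE; have [wW _|wW /= vw] := boolP (w \in W).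
      by apply/ideal_mulgen/bei_y.
    have -> : ff u v * yv w = - (yv u * ff v w) + yv v * ff u w by rewrite /fij; ring.
    by apply: ideal_add;
      [apply: ideal_opp|]; apply/ideal_mulgen/bei_edge => //; apply: sv.
move=> hp; apply: (@bei_regular _ _ u v); first exact: sym_fill.
- exact: irr_fill.
- by rewrite !inE negb_or uW se.
- by rewrite !inE negb_or vW ie.
- by [].
- by move=> a b _ _; rewrite /fill ie /= !orbF => -> -> ->; rewrite orbT.
- move=> a; rewrite !inE negb_or /fill => /andP[_ /negPf->].
  by rewrite (negPf nuv).
rewrite mulrC; apply: bei_mono hp; last exact: subsetUl.
by move=> i j eij _ _; rewrite /fill eij.
Qed.

Definition del_edge e u v : rel 'I_n :=
  fun a b => e a b && ~~ (((a == u) && (b == v)) || ((a == v) && (b == u))).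

Lemma sym_del_edge e u v : ssrbool.symmetric e -> ssrbool.symmetric (del_edge e u v).
Proof. by move=> se a b; rewrite /del_edge se orbC [(b == u) && _]andbC [(b == v) && _]andbC. Qed.

Lemma irr_del_edge e u v : ssrbool.irreflexive e -> ssrbool.irreflexive (del_edge e u v).
Proof. by move=> ie a; rewrite /del_edge ie. Qed.

Lemma bei_add_edge e W u v (p : S) : e u v ->
  bei e W p <-> exists q, bei (del_edge e u v) W (p - ff u v * q).
Proof.
move=> uv; split.
  elim=> [|{}p q _ [a ha] _ [b hb]|s g [i j ij|w wW|w wW]].
  - by exists 0; rewrite mulr0 subr0; apply: ideal_zero.
  - by exists (a + b); rewrite mulrDr opprD addrACA; apply: ideal_add.
  - have [/andP[/eqP-> /eqP->]|n1] := boolP ((i == u) && (j == v)).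
      by exists s; rewrite mulrC subrr; apply: ideal_zero.
    have [/andP[/eqP-> /eqP->]|n2] := boolP ((i == v) && (j == u)).
      by exists (- s); rewrite fijC mulrC mulNr mulrN subrr; apply: ideal_zero.
    exists 0; rewrite mulr0 subr0; apply/ideal_mulgen/bei_edge.
    by rewrite /del_edge ij negb_or n1 n2.
  - by exists 0; rewrite mulr0 subr0; apply/ideal_mulgen/bei_x.
  - by exists 0; rewrite mulr0 subr0; apply/ideal_mulgen/bei_y.
case=> q hq; rewrite -[p](subrK (ff u v * q)); apply: ideal_add.
  by apply: bei_mono hq => // i j /andP[].
by rewrite mulrC; apply/ideal_mulgen/bei_edge.
Qed.

Definition vertex_of (i : 'I_(n + n)) : 'I_n :=
  match split i with inl a => a | inr b => b end.

Lemma vertex_of_l i : vertex_of (l i) = i.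
Proof. by rewrite /vertex_of (unsplitK (inl i)). Qed.

Lemma vertex_of_r i : vertex_of (r i) = i.
Proof. by rewrite /vertex_of (unsplitK (inr i)). Qed.

Lemma bei_edgeless e W (p : S) :
  (forall i j, i \notin W -> j \notin W -> ~~ e i j) ->
  videal [pred i | vertex_of i \in W] p <->
  bei e W p.
Proof.
move=> e0; split=> [h|].
  rewrite (mpolyE p) big_seq; apply: ideal_sum => m; rewrite mcoeff_msupp => /h[i iW mi].
   apply: ideal_scale; rewrite -(@submK _ U_(i) m) ?lep1mP // mpolyXD.
  apply: ideal_mulgen; case: (split_ordP i) iW => a ->.
    by rewrite /= vertex_of_l => aW; apply: bei_x.
  by rewrite /= vertex_of_r => aW; apply: bei_y.
have hx w : w \in W -> videal [pred i | vertex_of i \in W] (xv w).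
  by move=> wW; apply: videalX; rewrite /= vertex_of_l.
have hy w : w \in W -> videal [pred i | vertex_of i \in W] (yv w).
  by move=> wW; apply: videalX; rewrite /= vertex_of_r.
elim=> [|{}p q _ hp _ hq|s g [i j ij|w /hx|w /hy]]; try exact: videalM.
- exact: videal0.
- exact: videalD.
apply: videalM; have [iW|iW] := boolP (i \in W).
  by apply: videalD; [rewrite mulrC | apply/videalN]; apply: videalM; auto.
have [jW|jW] := boolP (j \in W); last by rewrite (negPf (e0 _ _ iW jW)) in ij.
by apply: videalD; [|apply/videalN; rewrite mulrC]; apply: videalM; auto.
Qed.

Definition perfect_elimination (ord : 'I_n -> nat) e W := forall x y z,
  x \notin W -> y \notin W -> z \notin W -> e x y -> e x z ->
  (ord x < ord y)%N -> (ord x < ord z)%N -> y != z -> e y z.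

(** New edges join neighbours of u. The delicate case is one old and one new edge at x; it depends
    on the position of u relative to x. *)
Lemma perfect_elimination_fill ord e W W' u : injective ord -> ssrbool.symmetric e ->
  W \subset W' -> u \notin W' -> perfect_elimination ord e W -> perfect_elimination ord (fill e u) W'.
Proof.
move=> io se /subsetP sW uW' P x y z xW yW zW.
have notW a : a \notin W' -> a \notin W by apply/contra/sW.
have {}P a b c : a \notin W' -> b \notin W' -> c \notin W' -> e a b -> e a c ->
    (ord a < ord b)%N -> (ord a < ord c)%N -> b != c -> e b c.
  by move=> /notW aW /notW bW /notW cW; apply: P.
have key a b : a \notin W' -> b \notin W' -> x != a -> e x b -> e u x -> e u a ->
    (ord x < ord a)%N -> (ord x < ord b)%N -> a != b -> fill e u a b.
  move=> aW bW xa xb ux ua lxa lxb ab; rewrite /fill ua ab /= andbT.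
  (* If u precedes x, then xa was already an edge; if u = x, then b is a neighbour of u; if x
     precedes u, then u and b are later neighbours of x, hence equal or adjacent. *)
  have [lux|] := ltnP (ord u) (ord x).
    rewrite (P x a b) //; apply: (P u) => //.
    by apply: ltn_trans lux _.
  rewrite leq_eqVlt => /predU1P[/io xu|lxu]; first by rewrite -xu xb orbT.
  have [<-|ub] := eqVneq u b; first by rewrite se ua.
  by rewrite (P x u b) ?orbT // se.
rewrite {1 2}/fill => /orP[xy|/and3P[ux uy xy]] /orP[xz|/and3P[ux' uz xz]] lxy lxz yz.
- by rewrite /fill (P x y z).
- rewrite sym_fill //; apply: key => //; by rewrite eq_sym.
- exact: key.
- by rewrite /fill uy uz yz orbT.
Qed.

(** The lost edge could only be required by a common neighbour preceding both ends, but v comes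
    first among vertices with an edge. *)
Lemma perfect_elimination_del_edge ord e W u v : ssrbool.symmetric e ->
  u \notin W -> v \notin W -> e u v ->
  (forall a b, a \notin W -> b \notin W -> e a b -> (ord v <= ord a)%N) ->
  perfect_elimination ord e W -> perfect_elimination ord (del_edge e u v) W.
Proof.
move=> se uW vW uv vmin P x y z xW yW zW /andP[xy n1] /andP[xz n2] lxy lxz yz.
rewrite /del_edge (P x y z) //=; apply/negP => /orP[]/andP[/eqP yu /eqP zv].
  by move: lxz; rewrite zv ltnNge (vmin x y).
by move: lxy; rewrite yu ltnNge (vmin x y).
Qed.

(** Lexicographic induction on the number of non-isolated vertices outside [W], then the number of
    edges. Deleting uv lowers the second; passing to the colon ideal isolates v, which lowers the
    first. *)
Lemma kvanish_bei ord e W : injective ord -> ssrbool.symmetric e ->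
  ssrbool.irreflexive e -> perfect_elimination ord e W -> kvanish (@bei K n e W).
Proof.
move=> io.
pose NI e W := [set v | (v \notin W) && [exists y, (y \notin W) && e v y]].
pose E e := [set ab : 'I_n * 'I_n | e ab.1 ab.2].
have NIE e0 W0 v : (v \in NI e0 W0) = (v \notin W0) && [exists y, (y \notin W0) && e0 v y].
  by rewrite inE.
have EE e0 a b : ((a, b) \in E e0) = e0 a b by rewrite inE.
move: {2}#|NI e W| (leqnn #|NI e W|) => k; elim: k e W => [|k IHk] e W; last first.
  move: {2}#|E e| (leqnn #|E e|) => j; elim: j e W => [|j IHj] e W hE hN se ie P.
    apply: IHk => //; rewrite (leq_trans _ (leq0n _)) // leqn0 cards_eq0.
    apply/eqP/setP => v; rewrite !(NIE, EE, inE); apply/negbTE/negP.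
    case/andP=> _ /existsP[y /andP[_ vy]]; move: hE; rewrite leqn0 cards_eq0.
    by move/eqP/setP/(_ (v, y)); rewrite !(NIE, EE, inE) vy.
  have [N0|/set0Pn[v0 v0N]] := eqVneq (NI e W) set0.
    by apply: IHk; rewrite ?N0 ?cards0.
  case: (@arg_minnP _ v0 (fun v => v \in NI e W) ord v0N) => v.
  rewrite NIE => /andP[vW /existsP[u /andP[uW vu]]] vmin.
  have {}vmin a b : a \notin W -> b \notin W -> e a b -> (ord v <= ord a)%N.
    by move=> aW bW ab; apply: vmin; rewrite (NIE, EE, inE) aW; apply/existsP; exists b; rewrite bW.
  have uv : e u v by rewrite se.
  have nuv : u != v by apply: contraTneq uv => ->; rewrite ie.
  have lt a : a \notin W -> e v a -> (ord v < ord a)%N.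
    move=> aW va; rewrite ltn_neqAle (vmin a v) // ?[e a v]se // andbT.
    by apply: contraTneq va => /io <-; rewrite ie.
  pose e' := del_edge e u v.
  have se' : ssrbool.symmetric e' by apply: sym_del_edge.
  have ie' : ssrbool.irreflexive e' by apply: irr_del_edge.
  have P' : perfect_elimination ord e' W by apply: perfect_elimination_del_edge.
  have nuv' : ~~ e' u v by rewrite /e' /del_edge !eqxx andbF.
  (* Perfect elimination at v: its other neighbours come after v, as does u, hence they are adjacent
     to u. *)
  have sv w : w \notin W -> e' v w -> e' u w.
    move=> wW /andP[vw]; rewrite eqxx [v == u]eq_sym (negPf nuv) /= => wu.
    rewrite /e' /del_edge (P v u w) ?lt //=; last by rewrite eq_sym.
    by rewrite eqxx (negPf nuv) /= orbF; apply: contraTneq vw => ->; rewrite ie.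
  have sub : NI e' W \subset NI e W.
    apply/subsetP => a; rewrite !(NIE, EE, inE) => /andP[-> /existsP[b /andP[bW /andP[ab _]]]].
    by apply/existsP; exists b; rewrite bW.
  apply: (@kvanish_colon _ _ (bei e' W) _ _ (ff u v) 2) => //.
  - exact: fij_homog.
  - exact: hideal_bei.
  - exact: (hideal_bei _ (fill e' u) (W :|: [set w | e' v w])).
  - by move=> p; apply: bei_colon.
  - by move=> p; apply: bei_add_edge.
  - apply: IHj => //; last by apply: leq_trans hN; apply: subset_leq_card.
    rewrite -ltnS; apply: leq_trans hE; apply: proper_card; apply/properP; split.
      by apply/subsetP => -[a b]; rewrite !(NIE, EE, inE) => /andP[].
    by exists (u, v); rewrite !(NIE, EE, inE).
  apply: IHk; [|exact: sym_fill|exact: irr_fill|]; last first.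
    apply: perfect_elimination_fill P' => //; first exact: subsetUl.
    by rewrite !(NIE, EE, inE) negb_or uW se'.
  rewrite -ltnS; apply: leq_trans hN; apply: proper_card; apply/properP; split; last first.
    exists v; first by rewrite (NIE, EE, inE) vW; apply/existsP; exists u; rewrite uW.
    rewrite !(NIE, EE, inE); apply/negP => /andP[_ /existsP[y]]; rewrite !(NIE, EE, inE) negb_or.
    by case/andP=> /andP[_ /negPf vy]; rewrite /fill vy (negPf nuv').
  apply/subsetP => a; rewrite !(NIE, EE, inE) negb_or => /andP[/andP[aW _] /existsP[b]].
  rewrite !(NIE, EE, inE) negb_or aW /= => /andP[/andP[bW _]].
  case/orP=> [/andP[ab _]|/and3P[/andP[ua _] _ _]].
    by apply/existsP; exists b; rewrite bW.
  by apply/existsP; exists u; rewrite uW se.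
rewrite leqn0 cards_eq0 => /eqP N0 se ie P.
apply: (kvanish_ext _ (@kvanish_videal K _ [pred i | vertex_of i \in W])) => p.
apply: bei_edgeless => i j iW jW.
apply/negP => ij; have : i \in NI e W.
  by rewrite NIE iW; apply/existsP; exists j; rewrite jW.
by rewrite N0 inE.
Qed.

Lemma bei_in_JG e (p : S) : ssrbool.symmetric e -> ssrbool.irreflexive e ->
  bei e set0 p <-> in_JG e p.
Proof.
move=> se ie; split; last first.
  case=> c ->; apply: ideal_sum => i _; apply: ideal_sum => j /andP[_ ij].
  by apply/ideal_mulgen/bei_edge.
have one i j s : e i j -> (i < j)%N -> in_JG e (s * ff i j).
  move=> ij lij; exists (fun a b => if (a == i) && (b == j) then s else 0).
  rewrite (bigD1 i) //= (bigD1 j) ?lij //= !eqxx big1 => [|b /andP[_ /negPf->]]; last first.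
    by rewrite andbF mul0r.
  rewrite big1 ?addr0 // => a /negPf ai; rewrite big1 // => b _.
  by rewrite ai mul0r.
elim=> [|{}p q _ [c hc] _ [d hd]|s g [i j ij|w|w]]; rewrite ?inE //.
- by exists (fun _ _ => 0); rewrite big1 // => i _; rewrite big1 // => j _; rewrite mul0r.
- exists (fun i j => c i j + d i j); rewrite hc hd -big_split; apply: eq_bigr => i _ /=.
  by rewrite -big_split; apply: eq_bigr => j _ /=; rewrite mulrDl.
case: (ltngtP i j) => [lij|lji|/val_inj eij]; first exact: one.
  by rewrite fijC mulrN -mulNr; apply: one; rewrite // se.
by rewrite eij ie in ij.
Qed.

End Colon.

(** * Perfect elimination orderings *)

Section Dirac.
Local Open Scope nat_scope.

Variables (T : finType) (e : rel T).
Hypotheses (se : ssrbool.symmetric e) (ie : ssrbool.irreflexive e) (ce : chordal e).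

Lemma last_take_nth x (p : seq T) i : i <= size p -> last x (take i p) = nth x (x :: p) i.
Proof.
case: i => [|i] ip; first by rewrite take0.
by rewrite (last_nth x) size_take_min (minn_idPl ip) /= nth_take.
Qed.

(** A shortcut: the walk is followed up to its i-th vertex and resumed after its j-th one, x being
    vertex 0. *)
Lemma path_take_drop x p i j : path e x p -> i <= size p ->
  path e (nth x (x :: p) i) (drop j p) -> path e x (take i p ++ drop j p).
Proof. by move=> pe ip pd; rewrite cat_path take_path //= last_take_nth. Qed.

Lemma drop_last x p j : j <= size p ->
  last x p = last (nth x (x :: p) j) (drop j p) /\
  (path e x p -> path e (nth x (x :: p) j) (drop j p)).
Proof.
by elim: p x j => [|y p IH] x [|j] //= jp; have [-> h] := IH y j jp; split;
  [rewrite (set_nth_default x) | case/andP=> _ /h; rewrite (set_nth_default x)].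
Qed.

(* A shortest such walk would close up with x to an induced cycle. *)
Lemma chordal_no_detour x b b' p : e x b -> e x b' -> b != b' -> ~~ e b b' ->
  path e b p -> last b p = b' ->
  ~ {in p, forall c, [|| c == b, c == b' | (c != x) && ~~ e x c]}.
Proof.
move=> xb xb' bb' nbb' pe pl pg.
have [q [qe ql qg minq]] : exists q, [/\ path e b q, last b q = b',
    {in q, forall c, [|| c == b, c == b' | (c != x) && ~~ e x c]} &
    forall q', path e b q' -> last b q' = b' -> {subset q' <= q} -> size q <= size q'].
  pose P m := [exists q : m.-tuple T, [&& path e b q, last b q == b' &
    all (fun c => [|| c == b, c == b' | (c != x) && ~~ e x c]) q]].
  have exP : exists m, P m.
    exists (size p); apply/existsP; exists (in_tuple p).
    by rewrite /= pe pl eqxx; apply/allP.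
  case: (ex_minnP exP) => m /existsP[q /and3P[qe /eqP ql /allP qg]] min.
  exists q; split=> // q' h1 h2 h3; rewrite size_tuple; apply: min.
  apply/existsP; exists (in_tuple q').
  by rewrite /= h1 h2 eqxx; apply/allP => c /h3 /qg.
have sub i j : {subset take i q ++ drop j q <= q}.
  by move=> c; rewrite mem_cat => /orP[/mem_take|/mem_drop].
have us i j : i < j -> j <= size q -> nth b (b :: q) i != nth b (b :: q) j.
  move=> ij jq; apply/eqP => E; have [hl hp] := drop_last b jq.
  have iq : i <= size q by lia.
  have : size q <= size (take i q ++ drop j q).
    apply: minq => //; first by apply: path_take_drop; rewrite // E; apply: hp.
    by rewrite last_cat last_take_nth // E -hl.
  by rewrite size_cat size_drop size_take_min (minn_idPl iq); lia.
(* A chord would give a shorter walk; dropping only [j.-1] steps keeps the j-th vertex itself. *)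
have ch i j : i.+1 < j -> j <= size q -> ~~ e (nth b (b :: q) i) (nth b (b :: q) j).
  move=> ij jq; apply/negP => E; have [hl hp] := drop_last b jq.
  have dj : drop j.-1 q = nth b (b :: q) j :: drop j q.
    case: j ij jq E hl hp => [//|j] ij jq _ _ _ /=.
    by rewrite (drop_nth b).
  have iq : i <= size q by lia.
  have : size q <= size (take i q ++ drop j.-1 q).
    apply: minq => //; last by rewrite last_cat dj /= -hl.
    by apply: path_take_drop; rewrite // dj /= E hp.
  by rewrite size_cat dj /= size_drop size_take_min (minn_idPl iq); lia.
pose s := rcons (b :: q) x.
(* Since b and b' are distinct and not adjacent, the cycle through x, of length size q + 2, has
   length at least 4. *)
have q2 : 1 < size q.
  case: (q) ql qe => [|c [|c' q']] //=; first by move=> E; rewrite E eqxx in bb'.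
  by move=> ->; rewrite (negPf nbb').
have nb : nth b (b :: q) (size q) = b' by rewrite -last_nth.
have sx i : i <= size q -> nth b (b :: q) i != x.
  move=> iq; have [->|i0] := posnP i; first by apply: contraTneq xb => /= ->; rewrite ie.
  have : nth b (b :: q) i \in q by rewrite -(prednK i0) /= mem_nth // prednK.
  case/qg/or3P=> [/eqP->|/eqP->|/andP[]//]; first by apply: contraTneq xb => ->; rewrite ie.
  by apply: contraTneq xb' => ->; rewrite ie.
have xs i : i <= size q -> e x (nth b (b :: q) i) = (i == 0) || (i == size q).
  move=> iq; have [->|i0] := posnP i; first by rewrite /= xb.
  have [->|iq'] := eqVneq i (size q); first by rewrite nb xb' orbT.
  have : nth b (b :: q) i \in q by rewrite -(prednK i0) /= mem_nth // prednK.
  case/qg/or3P=> [/eqP E|/eqP E|/andP[_ /negPf]//].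
    by have := us 0 i i0 iq; rewrite E eqxx.
  by have := us i (size q); rewrite nb E eqxx ltn_neqAle iq' iq => /(_ isT (leqnn _)).
pose f (i : 'I_(size q).+2) := nth x s i.
have fs (i : 'I_(size q).+2) : f i = if i <= size q then nth b (b :: q) i else x.
  rewrite /f /s nth_rcons /= ltnS; case: ifP => iq; last by rewrite if_same.
  by apply: set_nth_default; rewrite /= ltnS.
have step i : i < size q -> e (nth b (b :: q) i) (nth b (b :: q) i.+1).
  by move=> iq; have /pathP := qe => /(_ b i iq).
have lt (i j : 'I_(size q).+2) : i < j ->
    f i != f j /\ e (f i) (f j) =
      (j == i.+1 %% (size q).+2 :> nat) || (i == j.+1 %% (size q).+2 :> nat).
  move=> ij; rewrite !fs; have jq := ltn_ord j; rewrite ltnS in jq.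
  have iq : i <= size q by rewrite -ltnS (leq_trans ij).
  rewrite iq [i.+1 %% _]modn_small ?ltnS //; case: ifPn => [jq'|jq'].
    rewrite [j.+1 %% _]modn_small ?ltnS //; split; first exact: us.
    have -> : (i == j.+1 :> nat) = false by apply/negbTE/eqP; lia.
    rewrite orbF; have [E|E] := eqVneq (j : nat) i.+1.
      by rewrite E step // -ltnS -E.
    by apply/negbTE/ch => //; lia.
  have Ej : (j : nat) = (size q).+1 by apply/eqP; rewrite eqn_leq jq ltnNge.
  split; first exact: sx.
  by rewrite se xs // Ej modnn eqSS orbC eq_sym.
apply: (ce (f := f)); split; first by rewrite !ltnS.
split.
  move=> i j fij; apply/val_inj; case: (ltngtP i j) => // /lt[]; by rewrite fij eqxx.
move=> i j; case: (ltngtP i j) => [/lt[]//|/lt[_]|/val_inj->].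
  by rewrite se orbC.
have jq := ltn_ord j; rewrite ie orbb; apply/esym/negbTE/eqP.
have [jm|jm] := eqVneq j.+1 (size q).+2; first by rewrite jm modnn; lia.
by rewrite modn_small ?ltn_neqAle ?jm //; lia.
Qed.

Definition simplicial (A : {set T}) y := forall a b,
  a \in A -> b \in A -> e y a -> e y b -> a != b -> e a b.

(** The induction needs a simplicial vertex away from x, unless x is adjacent to all. For z not
    adjacent to x, let C be its component among the non-neighbours of x, and B the neighbours of x
    adjacent to C. By chordality B is a clique. A vertex of C simplicial in the union of B and C is
    simplicial in A, as its neighbours all lie there. *)
Lemma dirac (A : {set T}) x : x \in A -> exists y, [/\ y \in A, simplicial A y &
  (forall a, a \in A -> a != x -> e x a) \/ (y != x /\ ~~ e x y)].
Proof.
move: {2}#|A| (leqnn #|A|) => k; elim: k A x => [|k IH] A x hA xA.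
  by move: hA; rewrite leqn0 cards_eq0 => /eqP A0; rewrite A0 inE in xA.
have small (A' : {set T}) : A' \subset A -> x \notin A' -> #|A'| <= k.
  move=> sA xA'; rewrite -ltnS; apply: leq_trans hA; apply: proper_card.
  by apply/properP; split=> //; exists x.
have [/forall_inP univ|] := boolP [forall a in A, (a != x) ==> e x a].
  have {}univ a : a \in A -> a != x -> e x a by move=> /univ/implyP.
  have [A0|/set0Pn[x' xA']] := eqVneq (A :\ x) set0.
    exists x; split=> //; last by left.
    by move=> a b aA _ xa; have := in_set0 a; rewrite -A0 !inE aA andbT => /negbFE/eqP E;
      rewrite E ie in xa.
  have [|y [yA ys _]] := IH (A :\ x) x' _ xA'.
    by apply: small; [apply: subsetDl | rewrite !inE eqxx].
  exists y; split; [by move: yA; rewrite inE => /andP[] | | by left].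
  move=> a b aA bA ya yb ab; have [ax|ax] := eqVneq a x.
    by rewrite ax univ // -ax eq_sym.
  have [bx|bx] := eqVneq b x; first by rewrite se bx univ.
  by apply: ys; rewrite // !inE ?ax ?bx.
case/forall_inPn=> z zA; rewrite negb_imply => /andP[zx nxz].
pose D := [set a in A | (a != x) && ~~ e x a].
pose R := [rel a b | [&& e a b, a \in D & b \in D]].
pose C := [set a | connect R z a].
pose B := [set b in A | e x b && [exists c in C, e b c]].
have zD : z \in D by rewrite inE zA zx.
have CD c : c \in C -> c \in D.
  rewrite inE => /connectP[p]; elim/last_ind: p c => [|p a _] c; first by move=> _ ->.
  by rewrite rcons_path last_rcons => /andP[_ /and3P[_ _ aD]] ->.
have CA c : c \in C -> c \in A by move/CD; rewrite inE => /andP[].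
have Cx c : c \in C -> (c != x) && ~~ e x c by move/CD; rewrite inE => /andP[].
have zC : z \in C by rewrite inE connect0.
have Cstep c d : c \in C -> d \in D -> e c d -> d \in C.
  move=> cC dD cd; have := cC; rewrite !inE => zc; apply: connect_trans zc _.
  by apply: connect1; rewrite /= cd dD CD.
have Cnbr c a : c \in C -> a \in A -> e c a -> a \in B :|: C.
  move=> cC aA ca; rewrite in_setU; have [xa|xa] := boolP (e x a).
    by rewrite inE aA xa /=; apply/orP; left; apply/exists_inP; exists c; rewrite // se.
  rewrite (Cstep c a) ?orbT // inE aA xa andbT.
  by apply: contraTneq ca => ->; rewrite se; case/andP: (Cx c cC).
have BA b : b \in B -> b \in A by rewrite inE => /andP[].
have Bclique b b' : b \in B -> b' \in B -> b != b' -> e b b'.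
  rewrite !inE => /and3P[bA xb /exists_inP[c cC bc]] /and3P[bA' xb' /exists_inP[c' cC' bc']] bb'.
  apply/contraT => nbb'; exfalso.
  have Rs : connect_sym R.
    by apply: sym_connect_sym => u v /=; rewrite se [(u \in D) && _]andbC.
  have /connectP[p pR pl] : connect R c c'.
    by apply: (connect_trans (y := z)); [rewrite Rs|]; [move: cC|move: cC']; rewrite inE.
  have pC : {subset c :: p <= C}.
    move=> d; rewrite inE => /predU1P[-> //|]; move: d.
    elim: p c cC pR {pl bc} => [//|a p IHp] c cC /= /andP[/and3P[ca _ aD] pR] d.
    have aC : a \in C by apply: Cstep ca.
    by rewrite inE => /predU1P[-> //|]; apply: IHp aC pR d.
  apply: (@chordal_no_detour x b b' (c :: rcons p b')) => //.
  - rewrite /= bc rcons_path -pl se bc' andbT /=.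
    by apply: sub_path pR => u v /andP[].
  - by rewrite /= last_rcons.
  move=> d; rewrite -rcons_cons mem_rcons inE => /predU1P[->|/pC/Cx ->].
    by rewrite eqxx orbT.
  by rewrite !orbT.
have [y [yC ys]] : exists y, y \in C /\ simplicial (B :|: C) y.
  have xB : x \notin B by rewrite inE ie andbF.
  have xC : x \notin C by apply/negP => /Cx; rewrite eqxx.
  (* If some b in B misses a vertex of the union, induction at b gives y not adjacent to b, so y is
     outside the clique B. Otherwise B is adjacent to everything and a simplicial vertex of C
     suffices. *)
  have [/exists_inP[b bB /exists_inP[a aA /andP[ab nba]]]|no] :=
    boolP [exists b in B, exists a in B :|: C, (a != b) && ~~ e b a].
    have [||y [yA ys]] := IH (B :|: C) b.
    - apply: small; last by rewrite in_setU negb_or xB.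
      by apply/subsetP => d; rewrite in_setU => /orP[/BA|/CA].
    - by rewrite in_setU bB.
    case=> [/(_ a aA ab)|[yb nby]]; first by rewrite (negPf nba).
    exists y; split=> //; move: yA; rewrite in_setU => /orP[yB|//].
    by rewrite Bclique // eq_sym in nby.
  have univ b a : b \in B -> a \in B :|: C -> a != b -> e b a.
    move=> bB aA ab; apply: contraNT no => nba; apply/exists_inP; exists b => //.
    by apply/exists_inP; exists a => //; rewrite ab.
  have [||y [yC ys _]] := IH C z; [by apply: small => //; apply/subsetP | by [] |].
  exists y; split=> // a b aA bA ya yb ab.
  have [aB|aB] := boolP (a \in B); first by rewrite univ // eq_sym.
  have [bB|bB] := boolP (b \in B); first by rewrite se univ.
  by move: aA bA; rewrite !in_setU (negPf aB) (negPf bB) => aC bC; apply: ys.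
exists y; split; [exact: CA | | by right; apply/andP/Cx].
by move=> a b aA bA ya yb; apply: ys => //; apply: (Cnbr y).
Qed.

Lemma chordal_elimination (A : {set T}) : exists ord : T -> nat,
  {in A &, injective ord} /\
  forall x y z, x \in A -> y \in A -> z \in A -> e x y -> e x z ->
    ord x < ord y -> ord x < ord z -> y != z -> e y z.
Proof.
move: {2}#|A| (leqnn #|A|) => k; elim: k A => [|k IH] A hA.
  move: hA; rewrite leqn0 cards_eq0 => /eqP->; exists (fun=> 0).
  by split=> [x|x y z]; rewrite inE.
have [->|/set0Pn[x0 x0A]] := eqVneq A set0.
  by exists (fun=> 0); split=> [x|x y z]; rewrite inE.
have [s [sA ss _]] := dirac x0A.
have [|ord [oi op]] := IH (A :\ s); first by move: hA; rewrite (cardsD1 s) sA.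
have inD a : a \in A -> a != s -> a \in A :\ s by move=> aA as_; rewrite !inE as_.
(* The simplicial vertex s comes first; the ordering of the rest is shifted by one. *)
exists (fun a => if a == s then 0 else (ord a).+1); split.
  move=> a b aA bA; case: eqVneq => [->|na]; case: eqVneq => [->|nb] // [].
  by apply: oi; apply: inD.
move=> x y z xA yA zA xy xz; case: (eqVneq y s) => // ny; case: (eqVneq z s) => // nz.
case: (eqVneq x s) => [xs _ _|nx]; last by rewrite !ltnS; apply: op => //; apply: inD.
by apply: ss; rewrite // -xs.
Qed.

End Dirac.

(** * Betti numbers of binomial edge ideals of chordal graphs *)

Theorem theorem3p11 (K : fieldType) (n : nat) (e : rel 'I_n)
  (He : simple_graph e) (Hconn : connected_graph e) (Hch : chordal e)
  (F : graded_free_resolution (@in_JG K n e)) (HF : minimal_resolution F) :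
  forall i j : nat, (2 * i < j)%N -> betti F i j = 0%N.
Proof.
move=> i j; have [se ie] := He.
have [ord [oi op]] := chordal_elimination se ie Hch [set: 'I_n].
have JE p := bei_in_JG (K := K) p se ie.
apply: betti_kvanish => //.
  have [h0 hD hM hP] := hideal_bei K e set0.
  split=> [|p q /JE hp /JE hq|s p /JE hp|Q p /JE hp]; apply/JE; auto.
apply: (kvanish_ext JE); apply: (@kvanish_bei _ _ ord) => //.
  by move=> a b; apply: oi; rewrite inE.
by move=> x y z _ _ _; apply: op; rewrite inE.
Qed.
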